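(* Let $a\in[0,\infty]$, let $K\ge1$ be an integer and let $\rho\in[0,1]$. Let $\varepsilon_0\sim\mathcal N(0,1)$ be independent of $L_{K,a}$. Then $(1-\rho^2)^{1/2}\varepsilon_0+\rho L_{K,a}$ is less dispersed than $\varepsilon_0$.
   Context: $L_{K,a}=\chi_{K,a}\,S\,\beta_K^{1/2}$ with $\chi_{K,a},S,\beta_K$ mutually independent, $\chi_{K,a}\ge0$, $\chi_{K,a}^2\sim(\chi_K^2\mid\chi_K^2\le a)$, $S$ uniform on $\{-1,1\}$, and $\beta_K\sim\mathrm{Beta}(1/2,(K-1)/2)$ (with $\beta_1\equiv1$). Equivalently, for $a>0$, $L_{K,a}\sim D_1\mid D^{T}D\le a$ where $D=(D_1,\dots,D_K)\sim\mathcal N(0,I_K)$. Conventions: $L_{K,0}=0$ almost surely and $L_{K,\infty}\sim\mathcal N(0,1)$. For random variables $X$ and $Y$ with quantile functions $F^{-1}$ and $G^{-1}$, $X$ is less dispersed than $Y$ if $F^{-1}(\beta)-F^{-1}(\alpha)\le G^{-1}(\beta)-G^{-1}(\alpha)$ for all $0<\alpha<\beta<1$. *)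

(* Defs.v *)
From HB Require Import structures.
From mathcomp Require Import all_boot all_order all_algebra.
From mathcomp Require Import all_classical all_reals all_analysis.
From mathcomp Require Import measurable_realfun.

Set Implicit Arguments.
Unset Strict Implicit.
Unset Printing Implicit Defensive.
Import Order.TTheory GRing.Theory Num.Theory.
Import numFieldNormedType.Exports.
Local Open Scope classical_set_scope.
Local Open Scope ring_scope.

Section laws.
Context {R : realType}.
Local Notation mu := (@lebesgue_measure R).

Definition gamma_fun (z : R) : R :=
  \int[mu]_(t in `]0, +oo[) (t `^ (z - 1) * expR (- t)).

(* The sign tests in the densities are needed: [x `^ p] is [1] for [x < 0]. *)
Definition chi2_pdf (K : nat) (x : R) : R :=
  if 0 < x then
    x `^ (K%:R / 2 - 1) * expR (- x / 2)
      / (2 `^ (K%:R / 2) * gamma_fun (K%:R / 2))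
  else 0.

Definition chi2_prob (K : nat) (A : set R) : \bar R :=
  (\int[mu]_(x in A) (chi2_pdf K x)%:E)%E.

(* The library's [beta_fun], [beta_pdf] and [beta_prob] only take natural
   parameters; here half-integers are needed. *)
Definition betaR_fun (p q : R) : R :=
  \int[mu]_(t in `]0, 1[) (t `^ (p - 1) * (1 - t) `^ (q - 1)).

Definition betaR_pdf (p q x : R) : R :=
  if 0 < x < 1 then
    x `^ (p - 1) * (1 - x) `^ (q - 1) / betaR_fun p q
  else 0.

Definition betaR_prob (p q : R) (A : set R) : \bar R :=
  (\int[mu]_(x in A) (betaR_pdf p q x)%:E)%E.

(* Law of beta_K: Beta(1/2, (K-1)/2), degenerate at 1 when K = 1. *)
Definition beta_law (K : nat) : set R -> \bar R :=
  if K == 1%N then \d_(1 : R) else betaR_prob (1 / 2) ((K%:R - 1) / 2).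

(* Conditional law of [nu] given the event [C]; meant for [nu C] positive. *)
Definition cond_law (nu : set R -> \bar R) (C A : set R) : \bar R :=
  (nu (A `&` C) / nu C)%E.

End laws.

Section random_variables.
Context d (T : measurableType d) (R : realType) (P : probability T R).

(* Equality is only required on Borel sets: away from them the values of the
   set functions above, and of the library's [normal_prob], are meaningless. *)
Definition has_law (X : T -> R) (nu : set R -> \bar R) : Prop :=
  forall A : set R, measurable A -> P (X @^-1` A) = nu A.

Definition indep2 (X Y : {RV P >-> R}) : Prop :=
  forall A B : set R, measurable A -> measurable B ->
    P (X @^-1` A `&` Y @^-1` B) = (P (X @^-1` A) * P (Y @^-1` B))%E.

(* Product rule for three events; taking some of them to be [setT] gives the
   rule for every subfamily, so this is mutual independence. *)
Definition mutual_indep3 (X Y Z : {RV P >-> R}) : Prop :=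
  forall A B C : set R, measurable A -> measurable B -> measurable C ->
    P (X @^-1` A `&` Y @^-1` B `&` Z @^-1` C)
    = (P (X @^-1` A) * P (Y @^-1` B) * P (Z @^-1` C))%E.

(* [L] is a version of L_{K,a}: the first and last branches are the
   conventions for a = +oo and a = 0; negative [a] is excluded. *)
Definition is_L (K : nat) (a : \bar R) (L : {RV P >-> R}) : Prop :=
  match a with
  | +oo%E => has_law L (normal_prob 0 1)
  | -oo%E => False
  | r%:E =>
      if 0 < r then
        exists chi S beta : {RV P >-> R},
          [/\ mutual_indep3 chi S beta,
              (\forall w \ae P, 0 <= chi w)
                /\ has_law (fun w => chi w ^+ 2)
                     (cond_law (chi2_prob K) `]-oo, r]),
              P (S @^-1` [set (-1)]) = (1 / 2)%:E
                /\ P (S @^-1` [set 1]) = (1 / 2)%:E,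
              has_law beta (beta_law K)
            & \forall w \ae P, L w = chi w * S w * Num.sqrt (beta w)]
      else r = 0 /\ \forall w \ae P, L w = 0
  end.

Definition quantile (X : {RV P >-> R}) (u : R) : R :=
  inf [set x : R | (u%:E <= cdf X x)%E].

End random_variables.

Definition less_dispersed (R : realType)
    d (T : measurableType d) (P : probability T R) (X : {RV P >-> R})
    d' (T' : measurableType d') (Q : probability T' R) (Y : {RV Q >-> R}) :
    Prop :=
  forall u v : R, 0 < u -> u < v -> v < 1 ->
    quantile X v - quantile X u <= quantile Y v - quantile Y u.

(* Main.v *)
Require Import Defs.
From HB Require Import structures.
From mathcomp Require Import all_boot all_order all_algebra.
From mathcomp Require Import all_classical all_reals all_analysis.
From mathcomp Require Import measurable_realfun.
From mathcomp Require Import ring lra.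

Set Implicit Arguments.
Unset Strict Implicit.
Unset Printing Implicit Defensive.
Import Order.TTheory GRing.Theory Num.Theory.
Import numFieldNormedType.Exports.
Local Open Scope classical_set_scope.
Local Open Scope ring_scope.

(** For [0 < a < +oo], the density of [L_{K,a}] is proportional to
    [e^(-l^2/2) G(a - l^2)], where [G] is the indicator of [[0, +oo)] if [K = 1]
    and otherwise the incomplete gamma integral of [y^((K-3)/2) e^(-y/2)] over
    [(0, s]].  In both cases [G] is nondecreasing and log-concave, so
    [g l := G(a - l^2)] is log-concave in [l].  By the symmetry of the bivariate
    normal density, [sqrt(1 - rho^2) eps0 + rho L] then has density [phi * h],
    where [phi] is the standard normal density and [h] is, up to the change of
    variable [y -> rho y], the convolution of [g] with a Gaussian kernel.  That
    kernel is variation diminishing, so [h] is log-concave.  For every [c] the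
    set where [phi x * h x] exceeds [phi (x - c)] is thus an interval, so that
    the distribution function of the sum crosses each translate of that of
    [eps0] at most once, from below; this is the dispersive ordering. *)

(** * Log-concave functions *)

(** The factor [G] comes from the chi-square decomposition: without truncation, [chi^2 * beta] and
    [chi^2 * (1 - beta)] are independent chi-square variables with 1 and [K - 1] degrees of freedom.
    Conditioning their sum to be at most [a] weights the value [z = l^2] of the first by the
    probability that the second is at most [a - z]; for [K = 1] the second is the constant 0, whence
    the indicator. Log-concavity is tested against exponentials because the same exponentials occur
    at every stage: a translate of the normal density divided by [phi] is an exponential, and
    Gaussian smoothing sends an exponential to an exponential of the same rate. The test also allows
    the values 0 and [+oo] and is insensitive to positive factors, so that normalising constants are
    never evaluated. Some cases escape the smoothing argument. For [a = 0] or [rho = 0] the sum is a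
    contraction of [eps0], which is compared with [eps0] outcome by outcome. For [rho = 1] the
    kernel degenerates and [g] itself plays the part of [h]. For [a = +oo] the function [g] is
    constant and has no bounded support. *)

Section exponential_inequalities.
Context {R : realType}.
Implicit Types (a b c s t u v w x y z : R).

Lemma expR_tangent x y : expR x * (1 + (y - x)) <= expR y.
Proof.
have -> : expR y = expR x * expR (y - x) by rewrite -expRD; congr expR; ring.
by rewrite ler_wpM2l ?expR_ge0// expR_ge1Dx.
Qed.

(** Convexity with denominators cleared: the tangent at the middle point bounds both ends, and the
    weights cancel its slope. *)
Lemma expR_three_points c u v w : u <= v -> v <= w ->
  (w - u) * expR (c * v) <= (w - v) * expR (c * u) + (v - u) * expR (c * w).
Proof.
move=> uv vw.
have h1 := expR_tangent (c * v) (c * u).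
have h2 := expR_tangent (c * v) (c * w).
have k1 : (w - v) * (expR (c * v) * (1 + (c * u - c * v))) <=
  (w - v) * expR (c * u) by rewrite ler_wpM2l// subr_ge0.
have k2 : (v - u) * (expR (c * v) * (1 + (c * w - c * v))) <=
  (v - u) * expR (c * w) by rewrite ler_wpM2l// subr_ge0.
apply: (le_trans _ (lerD k1 k2)); rewrite le_eqVlt; apply/orP; left.
by apply/eqP; ring.
Qed.

Lemma expR_le_max c x y z : x <= y -> y <= z ->
  expR (c * y) <= Num.max (expR (c * x)) (expR (c * z)).
Proof.
move=> xy yz; rewrite le_max !ler_expR; have [c0|c0] := leP 0 c.
  by rewrite (ler_wpM2l c0 yz) orbT.
by rewrite (ler_wnM2l (ltW c0) xy).
Qed.

(* [A e^(-a l) + B e^(b l)] is convex, and [A], [B] are chosen so that it takes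
   the value 1 at [s] and [t] (with a double contact when [s = t]). *)
Lemma expR_two_point_interpolation a b s t : 0 < a -> 0 < b -> s <= t ->
  exists A B : R, [/\ 0 <= A, 0 <= B,
    forall l : R, s <= l <= t -> A * expR (- a * l) + B * expR (b * l) <= 1 &
    forall l : R, l <= s \/ t <= l -> 1 <= A * expR (- a * l) + B * expR (b * l)].
Proof.
move=> a0 b0; rewrite le_eqVlt => /predU1P[<-|st].
- exists (b / (a + b) * expR (a * s)), (a / (a + b) * expR (- b * s)).
  have ab0 : 0 < a + b by rewrite addr_gt0.
  have abE : b / (a + b) + a / (a + b) = 1.
    by rewrite -mulrDl addrC divff// gt_eqF.
  have E l : b / (a + b) * expR (a * s) * expR (- a * l) +
      a / (a + b) * expR (- b * s) * expR (b * l) =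
      b / (a + b) * expR (- a * (l - s)) + a / (a + b) * expR (b * (l - s)).
    rewrite -!mulrA -!expRD; congr (_ * (_ * expR _) + _ * (_ * expR _)); ring.
  split.
  + by rewrite mulr_ge0 ?expR_ge0// divr_ge0// ltW.
  + by rewrite mulr_ge0 ?expR_ge0// divr_ge0// ltW.
  + move=> l /andP[sl ls]; have -> : l = s by apply/eqP; rewrite eq_le ls sl.
    by rewrite E subrr !mulr0 expR0 !mulr1 abE.
  + move=> l _; rewrite E.
    have h1 := expR_ge1Dx (- a * (l - s)).
    have h2 := expR_ge1Dx (b * (l - s)).
    have k1 := ler_wpM2l (divr_ge0 (ltW b0) (ltW ab0)) h1.
    have k2 := ler_wpM2l (divr_ge0 (ltW a0) (ltW ab0)) h2.
    apply: (le_trans _ (lerD k1 k2)); rewrite le_eqVlt; apply/orP; left.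
    by apply/eqP; rewrite -[LHS]abE; field; rewrite gt_eqF.
(* Cramer's rule for the two contact conditions; [D] is their determinant. *)
- pose D := expR (- a * s) * expR (b * t) - expR (- a * t) * expR (b * s).
  have D0 : 0 < D.
    rewrite /D subr_gt0 -!expRD ltr_expR -subr_gt0.
    have -> : - a * s + b * t - (- a * t + b * s) = (a + b) * (t - s) by ring.
    by rewrite mulr_gt0 ?subr_gt0// addr_gt0.
  pose A := (expR (b * t) - expR (b * s)) / D.
  pose B := (expR (- a * s) - expR (- a * t)) / D.
  have A0 : 0 <= A.
    rewrite divr_ge0 ?(ltW D0)// subr_ge0 ler_expR.
    by rewrite ler_pM2l// ltW.
  have B0 : 0 <= B.
    rewrite divr_ge0 ?(ltW D0)// subr_ge0 ler_expR !mulNr lerN2.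
    by rewrite ler_pM2l// ltW.
  pose k l := A * expR (- a * l) + B * expR (b * l).
  have ks : k s = 1 by rewrite /k /A /B /D; field; rewrite gt_eqF.
  have kt : k t = 1 by rewrite /k /A /B /D; field; rewrite gt_eqF.
  have kc u v w : u <= v -> v <= w ->
      (w - u) * k v <= (w - v) * k u + (v - u) * k w.
    move=> uv vw.
    have h1 := ler_wpM2l A0 (expR_three_points (- a) uv vw).
    have h2 := ler_wpM2l B0 (expR_three_points b uv vw).
    apply: (le_trans _ (le_trans (lerD h1 h2) _));
      rewrite le_eqVlt; apply/orP; left; apply/eqP; rewrite /k; ring.
  exists A, B; split => // l.
  + move=> /andP[sl lt]; have := kc _ _ _ sl lt; rewrite ks kt => h.
    have ts0 : 0 < t - s by rewrite subr_gt0.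
    rewrite -/(k l) -(ler_pM2l ts0); apply: (le_trans h).
    by rewrite le_eqVlt; apply/orP; left; apply/eqP; ring.
  + move=> ls; rewrite -/(k l); case: ls => [ls|tl].
    * have ts0 : 0 < t - s by rewrite subr_gt0.
      have := kc _ _ _ ls (ltW st); rewrite ks kt => h.
      rewrite -(ler_pM2l ts0); lra.
    * have ts0 : 0 < t - s by rewrite subr_gt0.
      have := kc _ _ _ (ltW st) tl; rewrite ks kt => h.
      rewrite -(ler_pM2l ts0); lra.
Qed.

End exponential_inequalities.

(* Log-concavity of a [[0, +oo]]-valued function: every exponential
   [M e^(c x)] is exceeded on a convex set. *)
Definition logconcave (R : realType) (h : R -> \bar R) : Prop :=
  forall M c x y z : R, 0 < M -> x < y -> y < z ->
    ((M * expR (c * x))%:E <= h x)%E -> ((M * expR (c * z))%:E <= h z)%E ->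
    ((M * expR (c * y))%:E <= h y)%E.

Section logconcave_closure.
Context {R : realType}.
Implicit Types (h g G : R -> \bar R).

Lemma logconcave_cst (k : \bar R) : logconcave (fun=> k).
Proof.
move=> M c x y z M0 xy yz hx hz.
have [E|E] := leP (expR (c * x)) (expR (c * z)).
- apply: le_trans hz; rewrite lee_fin ler_wpM2l ?(ltW M0)//.
  by have := expR_le_max c (ltW xy) (ltW yz); rewrite (max_idPr E).
- apply: le_trans hx; rewrite lee_fin ler_wpM2l ?(ltW M0)//.
  by have := expR_le_max c (ltW xy) (ltW yz); rewrite (max_idPl (ltW E)).
Qed.

Lemma logconcave_step : logconcave (fun s : R => if 0 <= s then 1%:E else 0%E).
Proof.
move=> M c x y z M0 xy yz; case: ifPn => [x0|_].
  have y0 : 0 <= y by rewrite (le_trans x0)// ltW.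
  by rewrite y0 (le_trans y0 (ltW yz)); exact: logconcave_cst.
by rewrite lee_fin leNgt mulr_gt0 ?expR_gt0.
Qed.

Lemma logconcaveZ (k : R) h : 0 <= k -> logconcave h ->
  logconcave (fun x => k%:E * h x)%E.
Proof.
rewrite le_eqVlt => /predU1P[<-|k0] lh M c x y z M0 xy yz.
  by rewrite mul0e lee_fin leNgt mulr_gt0 ?expR_gt0.
have E u : ((M * expR (c * u))%:E <= k%:E * h u)%E =
    ((k^-1 * M * expR (c * u))%:E <= h u)%E.
  by rewrite -lee_pdivrMl// -EFinM mulrA.
by rewrite !E; apply: lh; rewrite ?mulr_gt0 ?invr_gt0.
Qed.

Lemma logconcave_scale (k : R) h : 0 < k -> logconcave h ->
  logconcave (fun x => h (k * x)).
Proof.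
move=> k0 lh M c x y z M0 xy yz.
have E u : c * u = c / k * (k * u) by field; rewrite gt_eqF.
by rewrite (E x) (E y) (E z); apply: lh => //; rewrite ltr_pM2l.
Qed.

(** A concave function lies above its chords, so monotonicity of [G] reduces the claim to the chord
    [sb] of [a - l^2] over [[x, z]]. Along a chord that is not horizontal, an exponential in [l] is
    an exponential in the value of the chord. *)
Lemma logconcave_sub_sqr (a : R) G : {homo G : s t / s <= t >-> (s <= t)%E} ->
  logconcave G -> logconcave (fun l => G (a - l ^+ 2)).
Proof.
move=> ndG lG M c x y z M0 xy yz hx hz.
set sx := a - x ^+ 2 in hx *; set sz := a - z ^+ 2 in hz *.
set sy := a - y ^+ 2.
have xz : 0 < z - x by rewrite subr_gt0 (lt_trans xy).
pose sb := sx + (y - x) / (z - x) * (sz - sx).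
have sby : sb <= sy.
  rewrite -subr_ge0; have -> : sy - sb = (y - x) * (z - y).
    by rewrite /sy /sb /sz /sx; field; rewrite gt_eqF.
  by rewrite mulr_ge0// subr_ge0 ltW.
apply: le_trans (ndG _ _ sby).
have [E|NE] := eqVneq sx sz.
  have Eb : sb = sx by rewrite /sb E subrr mulr0 addr0.
  rewrite Eb; rewrite -E in hz.
  exact: (@logconcave_cst (G sx) M c x y z).
(* The affine change of variable sending [x], [y], [z] to [sx], [sb], [sz] turns [M e^(c l)] into
   [M' e^(c' s)]. *)
pose c' := c * (z - x) / (sz - sx).
pose M' := M * expR (c * x - c' * sx).
have NE' : sz - sx != 0 by rewrite subr_eq0 eq_sym.
have M'0 : 0 < M' by rewrite mulr_gt0 ?expR_gt0.
have Ex : M * expR (c * x) = M' * expR (c' * sx).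
  by rewrite /M' -mulrA -expRD; congr (_ * expR _); ring.
have Ez : M * expR (c * z) = M' * expR (c' * sz).
  rewrite /M' -mulrA -expRD; congr (_ * expR _); rewrite /c'; field; exact: NE'.
have Ey : M * expR (c * y) = M' * expR (c' * sb).
  rewrite /M' -mulrA -expRD; congr (_ * expR _); rewrite /c' /sb.
  by field; rewrite NE' gt_eqF.
rewrite Ex in hx; rewrite Ez in hz; rewrite Ey.
have th0 : 0 < (y - x) / (z - x) by rewrite divr_gt0// subr_gt0.
have th1 : (y - x) / (z - x) < 1 by rewrite ltr_pdivrMr// mul1r ltrD2r.
have [lt_xz|lt_zx|E] := ltgtP sx sz; last by rewrite E eqxx in NE.
- apply: (lG M' c' sx sb sz) => //.
    by rewrite /sb ltrDl mulr_gt0// subr_gt0.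
  rewrite -subr_gt0 (_ : _ - _ = (1 - (y - x) / (z - x)) * (sz - sx)); last first.
    by rewrite /sb; ring.
  by rewrite mulr_gt0// subr_gt0.
- apply: (lG M' c' sz sb sx) => //.
    rewrite -subr_gt0 (_ : _ - _ = (1 - (y - x) / (z - x)) * (sx - sz)); last first.
      by rewrite /sb; ring.
    by rewrite mulr_gt0// subr_gt0.
  rewrite -subr_gt0 (_ : _ - _ = (y - x) / (z - x) * (sx - sz)); last first.
    by rewrite /sb; ring.
  by rewrite mulr_gt0// subr_gt0.
Qed.

End logconcave_closure.

Lemma integral_itv_is_derive (R : realType) (F f : R -> R) (u v : R) : u <= v ->
  continuous f -> (forall x : R, is_derive x 1 F (f x)) ->
  (\int[@lebesgue_measure R]_(t in `]u, v]) (f t)%:E = (F v)%:E - (F u)%:E)%E.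
Proof.
rewrite le_eqVlt => /predU1P[<- _ _|uv cf dF].
  by rewrite set_itvoc0 integral_set0 subee.
have cF : continuous F.
  by move=> x; apply/differentiable_continuous/derivable1_diffP; have [] := dF x.
rewrite integral_itv_obnd_cbnd; last first.
  by apply/measurable_EFinP; apply: measurable_funTS; exact: continuous_measurable_fun.
apply: continuous_FTC2 => //.
- exact: continuous_subspaceT.
- split => /=.
  + by move=> x _; have [] := dF x.
  + by apply: cvg_at_right_filter; exact: cF.
  + by apply: cvg_at_left_filter; exact: cF.
- by move=> x _; rewrite derive1E; have [_ ->] := dF x.
Qed.

(** * Log-concavity of incomplete gamma integrals *)

Section lower_gamma.
Context {R : realType}.
Local Notation mu := (@lebesgue_measure R).

(** For [p > -1], up to a constant, the chi-square distribution function with [2 p + 2] degrees of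
    freedom. *)
Definition lower_gamma (p s : R) : \bar R :=
  (\int[mu]_(y in `]0%R, s]) (y `^ p * expR (- y / 2))%:E)%E.

Lemma lower_gamma_integrand_ge0 (p y : R) : 0 <= y `^ p * expR (- y / 2).
Proof. by rewrite mulr_ge0 ?powR_ge0 ?expR_ge0. Qed.

Lemma measurable_lower_gamma_integrand (p : R) (D : set R) :
  measurable D -> measurable_fun D (fun y : R => (y `^ p * expR (- y / 2))%:E).
Proof.
move=> mD; apply: measurable_funTS; apply/measurable_EFinP.
apply: measurable_funM; first exact: measurable_powR.
apply: measurableT_comp => //; exact: measurable_funM.
Qed.

Lemma lower_gamma_le0 (p s : R) : s <= 0 -> lower_gamma p s = 0%E.
Proof. by move=> s0; rewrite /lower_gamma set_itv_ge ?integral_set0// bnd_simp -leNgt. Qed.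

Lemma le_lower_gamma (p : R) :
  {homo lower_gamma p : s t / s <= t >-> (s <= t)%E}.
Proof.
move=> s t st; apply: ge0_subset_integral => //=.
- exact: measurable_lower_gamma_integrand.
- by move=> x _; rewrite lee_fin lower_gamma_integrand_ge0.
- by apply: subset_itvl; rewrite bnd_simp.
Qed.

Lemma integral_itv_expR (M c u v : R) : u <= v ->
  (\int[mu]_(t in `]u, v]) (M * c * expR (c * t))%:E =
   (M * expR (c * v))%:E - (M * expR (c * u))%:E)%E.
Proof.
move=> uv; apply: (integral_itv_is_derive (F := fun t => M * expR (c * t))) => //.
- move=> x; apply: cvgM; first exact: cvg_cst.
  by apply: continuous_comp; [exact: mulrl_continuous|exact: continuous_expR].
- by move=> x; apply: is_derive_eq; rewrite /GRing.scale/=; ring.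
Qed.

(** If the inequality failed at [y], comparing increments would give points of [(0, x]], [(x, y]]
    and [(y, z]] at which the integrand [q] is above, below and again above the derivative [e] of
    the exponential. But [q / e] is a multiple of [t^p e^(-k t)] with [k = 1/2 + c > 0], which never
    goes down and then up. *)
Lemma logconcave_lower_gamma (p : R) : logconcave (lower_gamma p).
Proof.
move=> M c x y z M0 xy yz hx hz.
have [x0|x0] := leP x 0.
  by move: hx; rewrite lower_gamma_le0// lee_fin leNgt mulr_gt0 ?expR_gt0.
have [c0|c0] := leP c 0.
  apply: le_trans (le_lower_gamma p (ltW xy)); apply: le_trans hx.
  by rewrite lee_fin ler_wpM2l ?(ltW M0)// ler_expR ler_wnM2l// ltW.
rewrite leNgt; apply/negP => hy.
pose q (t : R) := t `^ p * expR (- t / 2).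
pose e (t : R) := M * c * expR (c * t).
have e0 t : 0 < e t by rewrite /e !mulr_gt0 ?expR_gt0.
have split_gamma (u v : R) : 0 < u -> u < v -> lower_gamma p v =
    (lower_gamma p u + \int[mu]_(t in `]u, v]) (q t)%:E)%E.
  move=> u0 uv; rewrite /lower_gamma -ge0_integral_setU//=.
  - by rewrite -itv_bndbnd_setU//= bnd_simp ltW.
  - by apply: measurable_lower_gamma_integrand; exact: measurableU.
  - by move=> t _; rewrite lee_fin lower_gamma_integrand_ge0.
  - rewrite disj_set2E; apply/eqP; rewrite -subset0 => t [] /=; rewrite !in_itv/=.
    by move=> /andP[_ tu] /andP[ut _]; move: (lt_le_trans ut tu); rewrite ltxx.
have me (u v : R) : measurable_fun `]u, v] (fun t => (e t)%:E).
  apply: measurable_funTS; apply/measurable_EFinP.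
  by apply: measurable_funM => //; apply: measurableT_comp => //; exact: measurable_funM.
have mq (u v : R) : measurable_fun `]u, v] (fun t => (q t)%:E).
  exact: measurable_lower_gamma_integrand.
(* On a set where it stays below (above) the derivative [e] of the exponential,
   the integrand cannot catch up with (fall behind) it. *)
have le_int (u v : R) : u < v -> (forall t, u < t -> t <= v -> q t <= e t) ->
    (\int[mu]_(t in `]u, v]) (q t)%:E <= (M * expR (c * v) - M * expR (c * u))%:E)%E.
  move=> uv qe; rewrite EFinB -(integral_itv_expR _ _ (ltW uv)).
  apply: ge0_le_integral => //=.
  - by move=> t _; rewrite lee_fin lower_gamma_integrand_ge0.
  - exact: mq.
  - exact: me.
  - by move=> t; rewrite in_itv/= => /andP[ut tv]; rewrite lee_fin qe.
have ge_int (u v : R) : u < v -> (forall t, u < t -> t <= v -> e t <= q t) ->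
    ((M * expR (c * v) - M * expR (c * u))%:E <= \int[mu]_(t in `]u, v]) (q t)%:E)%E.
  move=> uv qe; rewrite EFinB -(integral_itv_expR _ _ (ltW uv)).
  apply: ge0_le_integral => //=.
  - by move=> t _; rewrite lee_fin ltW// e0.
  - exact: me.
  - exact: mq.
  - by move=> t; rewrite in_itv/= => /andP[ut tv]; rewrite lee_fin qe.
have [t1 /andP[t10 t1x] h1] : exists2 t : R, 0 < t <= x & e t < q t.
  apply: contrapT => /forall2NP H; move: hx; apply/negP; rewrite -ltNge.
  (* At 0 the exponential has the value [M > 0] and the integral the value 0; this gap makes the
     contradiction strict. *)
  apply: (@le_lt_trans _ _ (M * expR (c * x) - M * expR (c * 0))%:E).
    apply: le_int => // t t0 tx; rewrite leNgt; apply/negP => h.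
    by case: (H t) => //; rewrite t0 tx.
  by rewrite mulr0 expR0 mulr1 lte_fin ltrBlDr ltrDl.
have [t2 /andP[t2x t2y] h2] : exists2 t : R, x < t <= y & q t < e t.
  apply: contrapT => /forall2NP H; move: hy; apply/negP; rewrite -leNgt.
  rewrite (split_gamma x y)//.
  have -> : M * expR (c * y) =
      M * expR (c * x) + (M * expR (c * y) - M * expR (c * x)) by ring.
  rewrite EFinD leeD//; apply: ge_int => // t t0 tx; rewrite leNgt; apply/negP => h.
  by case: (H t) => //; rewrite t0 tx.
have [t3 /andP[t3y t3z] h3] : exists2 t : R, y < t <= z & e t < q t.
  apply: contrapT => /forall2NP H; move: hz; apply/negP; rewrite -ltNge.
  rewrite (split_gamma y z)//; last exact: lt_trans xy.
  have le_yz : forall t, y < t -> t <= z -> q t <= e t.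
    move=> t yt tz; rewrite leNgt; apply/negP => h.
    by case: (H t) => //; rewrite yt tz.
  have h := le_int _ _ yz le_yz.
  have fin_int : (\int[mu]_(t in `]y, z]) (q t)%:E)%E \is a fin_num.
    rewrite ge0_fin_numE ?(le_lt_trans h) ?ltry//.
    by apply: integral_ge0 => t _; rewrite lee_fin lower_gamma_integrand_ge0.
  have := lte_leD fin_int hy h.
  by rewrite -EFinD [X in X%:E]addrC subrK.
have t12 : t1 < t2 by exact: le_lt_trans t2x.
have t23 : t2 < t3 by exact: le_lt_trans t3y.
have t20 := lt_trans t10 t12; have t30 := lt_trans t20 t23.
(* In logarithmic scale the comparison of [q] with [e] is that of the function
   [p * ln t - k * t] with a constant; for [0 <= p] it lies below its tangent
   at [t2], for [p < 0] it is decreasing. *)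
pose k := 2^-1 + c.
have qE (t : R) : 0 < t -> (q t < e t) = (p * ln t - k * t < ln (M * c)).
  move=> t0; rewrite /q /e -[RHS]ltr_expR lnK; last by rewrite posrE mulr_gt0.
  rewrite /powR gt_eqF// -expRD -ltr_pdivrMr ?expR_gt0// -expRN -expRD.
  by congr (expR _ < _); rewrite /k; field.
have eqE (t : R) : 0 < t -> (e t < q t) = (ln (M * c) < p * ln t - k * t).
  move=> t0; rewrite /q /e -[RHS]ltr_expR lnK; last by rewrite posrE mulr_gt0.
  rewrite /powR gt_eqF// -expRD -ltr_pdivlMr ?expR_gt0// -expRN -expRD.
  by congr (_ < expR _); rewrite /k; field.
move: h1 h2 h3; rewrite qE// !eqE// => h1 h2 h3.
have ln_le (u v : R) : 0 < u -> 0 < v -> ln u - ln v <= u / v - 1.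
  move=> u0 v0; rewrite -ln_div ?posrE//.
  have -> : u / v = 1 + (u / v - 1) by ring.
  rewrite [leRHS](_ : _ = u / v - 1); last by ring.
  by apply: le_ln1Dx; rewrite ltrBrDl subrr divr_gt0.
have k0 : 0 < k by rewrite /k addr_gt0.
have [p0|p0] := leP 0 p; last first.
  have l23 : ln t2 <= ln t3 by rewrite ler_ln ?posrE// ltW.
  have : p * ln t3 <= p * ln t2 by rewrite ler_wnM2l// ltW.
  have : k * t2 <= k * t3 by rewrite ler_wpM2l// ltW.
  lra.
have l1 : p * (ln t1 - ln t2) <= p * (t1 / t2 - 1) by rewrite ler_wpM2l// ln_le.
have l3 : p * (ln t3 - ln t2) <= p * (t3 / t2 - 1) by rewrite ler_wpM2l// ln_le.
have [d|d] := leP (p / t2) k.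
- have : (p / t2 - k) * (t3 - t2) <= 0 by rewrite mulr_le0_ge0 ?subr_le0// subr_ge0 ltW.
  have -> : (p / t2 - k) * (t3 - t2) = p * (t3 / t2 - 1) - k * t3 + k * t2.
    by field; rewrite gt_eqF.
  lra.
- have : (p / t2 - k) * (t1 - t2) <= 0 by rewrite mulr_ge0_le0 ?subr_ge0 ?(ltW d)// subr_le0 ltW.
  have -> : (p / t2 - k) * (t1 - t2) = p * (t1 / t2 - 1) - k * t1 + k * t2.
    by field; rewrite gt_eqF.
  lra.
Qed.

End lower_gamma.

(** * Log-concavity under Gaussian smoothing *)

Section gaussian_smoothing.
Context {R : realType}.
Local Notation mu := (@lebesgue_measure R).
Variables (sigma : R) (sigma0 : sigma != 0).

Lemma normal_pdf_expR (m l : R) : normal_pdf m sigma l =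
  normal_peak sigma * expR (- (l - m) ^+ 2 / (sigma ^+ 2 *+ 2)).
Proof. by rewrite normal_pdfE. Qed.

Lemma normal_pdf_gt0 (m l : R) : 0 < normal_pdf m sigma l.
Proof. by rewrite normal_pdf_expR mulr_gt0 ?expR_gt0// normal_peak_gt0. Qed.

Lemma normal_pdf_ratio (m m' l : R) : normal_pdf m' sigma l =
  normal_pdf m sigma l * expR ((m ^+ 2 - m' ^+ 2) / (sigma ^+ 2 *+ 2)) *
    expR ((m' - m) / sigma ^+ 2 * l).
Proof.
rewrite !normal_pdf_expR -!mulrA -!expRD; congr (_ * expR _).
by field.
Qed.

Lemma expR_normal_pdf (c m l : R) : expR (c * l) * normal_pdf m sigma l =
  expR (c * m + c ^+ 2 * sigma ^+ 2 / 2) *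
    normal_pdf (m + c * sigma ^+ 2) sigma l.
Proof.
rewrite !normal_pdf_expR !(mulrCA _ (normal_peak _)) -!expRD.
by congr (_ * expR _); field.
Qed.

(** Tilting a normal density by [e^(c l)] shifts its mean by [c sigma^2]. Hence smoothing preserves
    the rate [c] and only changes the factor [M]. *)
Lemma integral_expR_normal_pdf (M c m : R) : 0 <= M ->
  (\int[mu]_l (normal_pdf m sigma l * (M * expR (c * l)))%:E =
   (M * expR (c * m + c ^+ 2 * sigma ^+ 2 / 2))%:E)%E.
Proof.
move=> M0; rewrite -[RHS]mule1 -(integral_normal_pdf (m + c * sigma ^+ 2) sigma).
rewrite -ge0_integralZl_EFin//=.
- apply: eq_integral => l _; rewrite -EFinM; congr (_%:E).
  by rewrite -[RHS]mulrA -expR_normal_pdf; ring.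
- by move=> l _; rewrite lee_fin normal_pdf_ge0.
- by apply/measurable_EFinP; exact: measurable_normal_pdf.
- by rewrite mulr_ge0 ?expR_ge0.
Qed.

(* The Gaussian kernel is variation diminishing.  [D := g - E], with [E] an
   exponential, is nonnegative exactly on an interval; for [p < q < r] some
   combination [k_q - A k_p - B k_r] of kernels with [A, B >= 0] has the same
   sign as [D], so that [\int k_q D >= A \int k_p D + B \int k_r D]. *)
Lemma logconcave_normal_smoothing (g : R -> \bar R) (b : R) :
  measurable_fun setT g -> (forall l, 0 <= g l)%E ->
  (forall l, b < `|l| -> g l = 0%E) -> logconcave g ->
  logconcave (fun m => \int[mu]_l ((normal_pdf m sigma l)%:E * g l))%E.
Proof.
move=> mg g0 gb lg M c p q r M0 pq qr hp hr.
(* [M'] is chosen so that the smoothing of [E] is exactly [M e^(c m)]. *)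
pose M' := M * expR (- (c ^+ 2 * sigma ^+ 2 / 2)).
have M'0 : 0 < M' by rewrite mulr_gt0 ?expR_gt0.
pose E l := M' * expR (c * l).
have E0 l : 0 < E l by rewrite mulr_gt0 ?expR_gt0.
pose k m l := normal_pdf m sigma l.
have k0 m l : 0 < k m l by exact: normal_pdf_gt0.
have intE m : (\int[mu]_l (k m l * E l)%:E = (M * expR (c * m))%:E)%E.
  rewrite integral_expR_normal_pdf ?(ltW M'0)//; congr (_%:E).
  by rewrite /M' -mulrA -expRD; congr (_ * expR _); ring.
pose I := [set l | ((E l)%:E <= g l)%E].
have I_b l : I l -> - b <= l <= b.
  move=> Il; rewrite -ler_norml leNgt; apply/negP => bl.
  by move: Il; rewrite /I/= gb// lee_fin leNgt E0.
(* [I] is convex because [g] is log-concave, and bounded because [g] has bounded support. It need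
   not contain its endpoints, so its complement is only located by non-strict inequalities. *)
have [s [t [st Ist Iout]]] : exists s t : R, [/\ s <= t,
    forall l, I l -> s <= l <= t & forall l, ~ I l -> l <= s \/ t <= l].
  have [I0|/set0P[i Ii]] := eqVneq I set0.
    exists 0, 0; split => //; first by move=> l; rewrite I0.
    by move=> l _; have [?|/ltW] := leP l 0; [left|right].
  have lbI : has_inf I by split; [exists i|exists (- b) => l /I_b /andP[]].
  have ubI : has_sup I by split; [exists i|exists b => l /I_b /andP[]].
  have infI l : I l -> inf I <= l by move=> Il; apply: ge_inf => //; exact: lbI.2.
  have supI l : I l -> l <= sup I by move=> Il; apply: ub_le_sup => //; exact: ubI.2.
  exists (inf I), (sup I); split.
  - exact: le_trans (infI _ Ii) (supI _ Ii).
  - by move=> l Il; rewrite infI ?supI.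
  - move=> l NIl; apply: contrapT => /not_orP[/negP]; rewrite -ltNge => il.
    move=> /negP; rewrite -ltNge => ls.
    have [i1 Ii1 i1l] := inf_lt lbI.1 il.
    have [i2 Ii2 li2] := sup_gt ubI.1 ls.
    by apply: NIl; exact: (lg M' c i1 l i2).
have s2 : 0 < sigma ^+ 2 by rewrite exprn_even_gt0.
have a0 : 0 < (q - p) / sigma ^+ 2 by rewrite divr_gt0// subr_gt0.
have b0 : 0 < (r - q) / sigma ^+ 2 by rewrite divr_gt0// subr_gt0.
have [A [B [A0 B0 le1 ge1]]] := expR_two_point_interpolation a0 b0 st.
(* The ratios [k p / k q] and [k r / k q] are exponentials of rates [-(q - p) / sigma^2] and
   [(r - q) / sigma^2]; [A'] and [B'] absorb their constant factors, so that
   [A' k_p + B' k_r = k_q K]. *)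
pose A' := A * expR ((p ^+ 2 - q ^+ 2) / (sigma ^+ 2 *+ 2)).
pose B' := B * expR ((r ^+ 2 - q ^+ 2) / (sigma ^+ 2 *+ 2)).
have A'0 : 0 <= A' by rewrite mulr_ge0 ?expR_ge0.
have B'0 : 0 <= B' by rewrite mulr_ge0 ?expR_ge0.
pose K l := A * expR (- ((q - p) / sigma ^+ 2) * l) + B * expR ((r - q) / sigma ^+ 2 * l).
have K0 l : 0 <= K l by rewrite addr_ge0// mulr_ge0 ?expR_ge0.
have KE l : A' * k p l + B' * k r l = k q l * K l.
  rewrite /k (normal_pdf_ratio q p) (normal_pdf_ratio q r) /K mulrDr /A' /B'.
  have e1 : expR ((p ^+ 2 - q ^+ 2) / (sigma ^+ 2 *+ 2)) *
      expR ((q ^+ 2 - p ^+ 2) / (sigma ^+ 2 *+ 2)) = 1.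
    by rewrite -expRD -expR0; congr expR; field.
  have e2 : expR ((r ^+ 2 - q ^+ 2) / (sigma ^+ 2 *+ 2)) *
      expR ((q ^+ 2 - r ^+ 2) / (sigma ^+ 2 *+ 2)) = 1.
    by rewrite -expRD -expR0; congr expR; field.
  have -> : (p - q) / sigma ^+ 2 = - ((q - p) / sigma ^+ 2) by field.
  set u1 := expR (- _ * l); set u2 := expR (_ * l).
  congr (_ + _).
  - rewrite -[in RHS](mul1r u1) -e1; ring.
  - rewrite -[in RHS](mul1r u2) -e2; ring.
have KE' l : A' * (k p l * E l) + B' * (k r l * E l) = k q l * (K l * E l).
  by rewrite [RHS]mulrA -(KE l) mulrDl !mulrA.
(* This is [(1 - K l) (g l - E l) >= 0], written without subtraction because [g l] may be [+oo]. *)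
have key l : ((E l)%:E + (K l)%:E * g l <= g l + (K l * E l)%:E)%E.
  have [Il|NIl] := pselect (I l).
    have K1 : K l <= 1 by apply: le1; exact: Ist.
    move: Il; rewrite /I/=; case: (g l) => [x| |//].
      rewrite -EFinM -!EFinD !lee_fin => Ex; have : 0 <= (1 - K l) * (x - E l).
        by rewrite mulr_ge0// subr_ge0.
      lra.
    by move=> _; rewrite addye// leey.
  have K1 : 1 <= K l by apply: ge1; exact: Iout.
  move: NIl (g0 l); rewrite /I/= => /negP; rewrite -ltNge.
  case: (g l) => [x| |//]; last by rewrite ltNge leey.
  rewrite lte_fin => xE _; rewrite -EFinM -!EFinD lee_fin.
  have : 0 <= (K l - 1) * (E l - x) by rewrite mulr_ge0 ?subr_ge0// ltW.
  lra.
pose J m := (\int[mu]_l ((k m l)%:E * g l))%E.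
have mk m : measurable_fun setT (fun l => (k m l)%:E).
  by apply/measurable_EFinP; exact: measurable_normal_pdf.
have mkg m : measurable_fun setT (fun l => (k m l)%:E * g l)%E.
  exact: emeasurable_funM.
have mkE m : measurable_fun setT (fun l => (k m l * E l)%:E).
  apply/measurable_EFinP; apply: measurable_funM; first exact: measurable_normal_pdf.
  by apply: measurable_funM => //; apply: measurableT_comp => //; exact: measurable_funM.
have kg0 m l : (0 <= (k m l)%:E * g l)%E by rewrite mule_ge0// lee_fin ltW.
have kE0 m l : (0 <= (k m l * E l)%:E)%E by rewrite lee_fin mulr_ge0 ?ltW.
have comb0 (f1 f2 : R -> \bar R) l : (0 <= f1 l)%E -> (0 <= f2 l)%E ->
    (0 <= A'%:E * f1 l + B'%:E * f2 l)%E.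
  by move=> f10 f20; rewrite adde_ge0// mule_ge0// lee_fin.
have mcomb (f1 f2 : R -> \bar R) : measurable_fun setT f1 ->
    measurable_fun setT f2 ->
    measurable_fun setT (fun l => A'%:E * f1 l + B'%:E * f2 l)%E.
  by move=> mf1 mf2; apply: emeasurable_funD; exact: measurable_funeM.
have int_comb (f f1 f2 : R -> \bar R) : measurable_fun setT f ->
    measurable_fun setT f1 -> measurable_fun setT f2 ->
    (forall l, 0 <= f l)%E -> (forall l, 0 <= f1 l)%E -> (forall l, 0 <= f2 l)%E ->
    (\int[mu]_l (f l + (A'%:E * f1 l + B'%:E * f2 l)) =
     \int[mu]_l f l + (A'%:E * \int[mu]_l f1 l + B'%:E * \int[mu]_l f2 l))%E.
  move=> mf mf1 mf2 f0 f10 f20.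
  rewrite ge0_integralD//=; [|by move=> l _; exact: comb0|exact: mcomb].
  rewrite ge0_integralD//=; last 4 first.
  - by move=> l _; rewrite mule_ge0// lee_fin.
  - exact: measurable_funeM.
  - by move=> l _; rewrite mule_ge0// lee_fin.
  - exact: measurable_funeM.
  by rewrite !ge0_integralZl_EFin.
have main : ((M * expR (c * q))%:E + (A'%:E * J p + B'%:E * J r) <=
    J q + (A'%:E * (M * expR (c * p))%:E + B'%:E * (M * expR (c * r))%:E))%E.
  rewrite -!intE /J -!int_comb//; apply: ge0_le_integral => //=.
  - by move=> l _; rewrite adde_ge0 ?kE0// adde_ge0// mule_ge0// lee_fin.
  - by apply: emeasurable_funD; [exact: mkE|exact: (mcomb _ _ (mkg p) (mkg r))].
  - by apply: emeasurable_funD; [exact: mkg|exact: (mcomb _ _ (mkE p) (mkE r))].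
  - move=> l _; have M0' := ltW M0; have k0' m := ltW (k0 m l); have E0' := ltW (E0 l).
    have -> : (A'%:E * ((k p l)%:E * g l) + B'%:E * ((k r l)%:E * g l) =
        (k q l)%:E * ((K l)%:E * g l))%E.
      by rewrite !muleA -!EFinM -(KE l) EFinD ge0_muleDl// lee_fin mulr_ge0.
    have -> : (A'%:E * (k p l * E l)%:E + B'%:E * (k r l * E l)%:E =
        (k q l)%:E * (K l * E l)%:E)%E.
      by rewrite -!EFinM -EFinD KE'.
    rewrite EFinM -!ge0_muleDr ?mule_ge0// ?lee_fin ?mulr_ge0//.
    by apply: lee_wpmul2l; rewrite ?lee_fin.
have EE0 m : 0 <= M * expR (c * m) by rewrite mulr_ge0 ?expR_ge0// ltW.
(* Only the finite quantity [S] gets cancelled; [J p] and [J r] may be infinite. *)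
move: main; set S := (A'%:E * _%:E + B'%:E * _)%E.
have S_le : (S <= A'%:E * J p + B'%:E * J r)%E.
  by apply: leeD; [apply: (lee_wpmul2l _ hp)|apply: (lee_wpmul2l _ hr)]; rewrite lee_fin.
have S_fin : S \is a fin_num by rewrite /S -!EFinM -EFinD.
move=> main; rewrite -(leeD2rE _ _ S_fin); apply: le_trans main.
exact: leeD2l.
Qed.

End gaussian_smoothing.

(** * Dispersive ordering *)

Section quantile_theory.
Context d (T : measurableType d) (R : realType) (P : probability T R).
Variable X : {RV P >-> R}.
Variables (u : R) (u0 : 0 < u) (u1 : u < 1).

Let near_cdf_gt : \forall x \near +oo%R, (u%:E < cdf X x)%E.
Proof.
have : nbhs (1%E : \bar R) [set z | (u%:E < z)%E].
  by apply: open_nbhs_nbhs; split => //=; exact: open_ereal_gt_ereal.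
by move/(cvg_cdfy1 X); rewrite nbhs_filterE.
Qed.

Let near_cdf_lt : \forall x \near -oo%R, (cdf X x < u%:E)%E.
Proof.
have : nbhs (0%E : \bar R) [set z | (z < u%:E)%E].
  by apply: open_nbhs_nbhs; split => //=; exact: open_ereal_lt_ereal.
by move/(cvg_cdfNy0 X); rewrite nbhs_filterE.
Qed.

Let has_inf_quantile : has_inf [set x : R | (u%:E <= cdf X x)%E].
Proof.
have [x hx] := filter_ex near_cdf_gt.
have [y hy] := filter_ex near_cdf_lt.
split; first by exists x; exact: ltW.
exists y => z /= hz; rewrite leNgt; apply/negP => zy.
have := le_trans hz (cdf_nondecreasing X (ltW zy)).
by rewrite leNgt hy.
Qed.

Lemma cdf_lt_quantile (x : R) : x < quantile X u -> (cdf X x < u%:E)%E.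
Proof.
move=> xq; rewrite ltNge; apply/negP => h; move: xq; rewrite ltNge => /negP; apply.
by apply: ge_inf => //; exact: has_inf_quantile.2.
Qed.

Lemma le_cdf_quantile (x : R) : quantile X u < x -> (u%:E <= cdf X x)%E.
Proof.
move=> /(inf_lt has_inf_quantile.1)[y /= uy yx].
by apply: le_trans uy _; exact: cdf_nondecreasing (ltW yx).
Qed.

End quantile_theory.

(* Dispersive ordering as a single-crossing property: no translate of the
   distribution function of [Y] is crossed from above by that of [X]. *)
Lemma less_dispersed_of_crossing (R : realType)
    d (T : measurableType d) (P : probability T R) (X : {RV P >-> R})
    d' (T' : measurableType d') (Q : probability T' R) (Y : {RV Q >-> R}) :
  (forall c x y : R, x < y ->
    (cdf Y (x - c) < cdf X x -> cdf Y (y - c) <= cdf X y)%E) ->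
  less_dispersed X Y.
Proof.
move=> cross u v u0 uv v1; have u1 := lt_trans uv v1; have v0 := lt_trans u0 uv.
set x := quantile X u; set y := quantile X v.
set s := quantile Y u; set t := quantile Y v.
rewrite leNgt; apply/negP => h.
(* Needed for [x' < y'] below. *)
have st : s <= t.
  rewrite leNgt; apply/negP => ts; pose z := (s + t) / 2.
  have /(cdf_lt_quantile u0 u1) : z < quantile Y u by rewrite -/s /z; lra.
  have /(le_cdf_quantile v0 v1) : quantile Y v < z by rewrite -/t /z; lra.
  by move=> /le_lt_trans/[apply]; rewrite lte_fin ltNge ltW.
(* By [h], [x - s < y - t], and [c] is the midpoint. Then [x'] lies strictly between [x] and
   [s + c], and [y'] strictly between [t + c] and [y]: the distribution functions are evaluated off
   the quantiles, where the bounds are available. *)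
pose c := ((x - s) + (y - t)) / 2.
pose x' := (x + s + c) / 2; pose y' := (y + t + c) / 2.
have xx' : x < x' by rewrite /x' /c; lra.
have x's : x' - c < s by rewrite /x' /c; lra.
have y'y : y' < y by rewrite /y' /c; lra.
have ty' : t < y' - c by rewrite /y' /c; lra.
have x'y' : x' < y' by rewrite /x' /y' /c; lra.
have h1 := le_cdf_quantile u0 u1 xx'.
have h2 := cdf_lt_quantile u0 u1 x's.
have h3 := cross c _ _ x'y' (lt_le_trans h2 h1).
have h4 := le_trans (le_cdf_quantile v0 v1 ty') h3.
by have := cdf_lt_quantile v0 v1 y'y; rewrite ltNge h4.
Qed.

(* The measure structure of [pushforward] is not inferred by unification: it
   depends on a proof that the map is measurable. *)
Definition pushforward_measure d d' (T1 : measurableType d)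
    (T2 : measurableType d') (R : realType) (m : {measure set T1 -> \bar R})
    (f : T1 -> T2) (mf : measurable_fun setT f) : {measure set T2 -> \bar R} :=
  measure_function_pushforward__canonical__measure_function_Measure m mf.

Section affine_substitution.
Context {R : realType}.
Local Notation mu := (@lebesgue_measure R).
Variables (s m : R) (s0 : 0 < s).

Let affine (t : measurableTypeR R) : measurableTypeR R := s * t + m.

Let measurable_affine : measurable_fun setT affine.
Proof. by apply: measurable_funD => //; exact: measurable_funM. Qed.

Let affine_measure : {measure set (measurableTypeR R) -> \bar R} :=
  mscale (NngNum (ltW s0)) (pushforward_measure mu measurable_affine).

Let affine_measureE (A : set R) : measurable A -> mu A = affine_measure A.
Proof.
apply: lebesgue_measure_unique => _ [[a b] _ <-].
rewrite /affine_measure /= /mscale/= /pushforward.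
rewrite (_ : affine @^-1` _ = `](a - m) / s, (b - m) / s]%classic); last first.
  apply/seteqP; split => t /=; rewrite !in_itv/= /affine.
    by rewrite ltr_pdivrMr// ler_pdivlMr// ltrBlDr lerBrDr [s * _]mulrC.
  by rewrite ltr_pdivrMr// ler_pdivlMr// ltrBlDr lerBrDr [s * _]mulrC.
rewrite !lebesgue_measure_itv/= !lte_fin ltr_pM2r ?invr_gt0// ltrD2r.
case: ifPn => _; last by rewrite mule0.
by rewrite -!EFinB -EFinM; congr (_%:E); field; rewrite gt_eqF.
Qed.

Lemma ge0_integral_affine (A : set R) (f : R -> \bar R) : measurable A ->
  measurable_fun A f -> (forall x, A x -> 0 <= f x)%E ->
  (\int[mu]_(x in A) f x =
   s%:E * \int[mu]_(t in (fun t : R => s * t + m)%R @^-1` A) f (s * t + m)%R)%E.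
Proof.
move=> mA mf f0; rewrite (eq_measure_integral affine_measure); last first.
  by move=> B mB _; exact: affine_measureE.
rewrite ge0_integral_mscale//; congr (_ * _)%E.
by rewrite ge0_integral_pushforward// => y /[!inE]; exact: f0.
Qed.

End affine_substitution.

(** * From a log-concave likelihood ratio to the dispersive ordering *)

Section density_crossing.
Context {R : realType}.
Local Notation mu := (@lebesgue_measure R).

Lemma normal_pdf01_shift (c t : R) : normal_pdf 0 1 (t - c) =
  normal_pdf 0 1 t * (expR (- (c ^+ 2 / 2)) * expR (c * t)).
Proof.
rewrite !normal_pdf_expR ?oner_neq0// -expRD -mulrA -expRD.
by congr (_ * expR _); field.
Qed.

(** A crossing from above between [x] and [y] forces [h] to reach the exponential [M e^(c t)] at
    some [p <= x] and some [r > y], and to stay strictly below it at some [q] in [(x, y]].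
    Log-concavity forbids this. *)
Lemma less_dispersed_normal_density
    d (T : measurableType d) (P : probability T R) (X : {RV P >-> R})
    d' (T' : measurableType d') (Q : probability T' R) (Y : {RV Q >-> R})
    (h : R -> \bar R) :
  measurable_fun setT h -> (forall t, 0 <= h t)%E -> logconcave h ->
  has_law P X (fun A => \int[mu]_(t in A) ((normal_pdf 0 1 t)%:E * h t))%E ->
  has_law Q Y (normal_prob 0 1) ->
  less_dispersed X Y.
Proof.
move=> mh h0 lh lX lY; apply: less_dispersed_of_crossing => c x y xy.
pose f t := ((normal_pdf 0 1 t)%:E * h t)%E.
pose M := expR (- (c ^+ 2 / 2)).
(* [e] is the density of [Y + c], so comparing the two densities amounts to comparing [h] with an
   exponential. *)
pose e (t : R) := ((normal_pdf 0 1 t)%:E * (M * expR (c * t))%:E)%E.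
pose F A := P (X @^-1` A); pose G A := Q ((fun w => Y w + c) @^-1` A).
have phi0 t : (0 < (normal_pdf 0 1 t : R)%:E)%E.
  by rewrite lte_fin normal_pdf_gt0// oner_neq0.
have mphi : measurable_fun setT (fun t : R => (normal_pdf 0 1 t)%:E).
  by apply/measurable_EFinP; exact: measurable_normal_pdf.
have mf : measurable_fun setT f by exact: emeasurable_funM.
have me : measurable_fun setT e.
  apply: emeasurable_funM => //; apply/measurable_EFinP; apply: measurable_funM => //.
  by apply: measurableT_comp => //; exact: measurable_funM.
have f0 t : (0 <= f t)%E by rewrite mule_ge0// ltW.
have e0 t : (0 <= e t)%E by rewrite mule_ge0 ?(ltW (phi0 t))// lee_fin mulr_ge0 ?expR_ge0.
have FE A : measurable A -> F A = (\int[mu]_(t in A) f t)%E by move=> mA; rewrite /F lX.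
have GE (A : set R) : measurable A -> G A = (\int[mu]_(t in A) e t)%E.
  move=> mA; rewrite /G (_ : _ @^-1` A = Y @^-1` ((fun t => 1 * t + c) @^-1` A)); last first.
    by apply/seteqP; split => w /=; rewrite mul1r.
  rewrite lY; last first.
    rewrite -[X in measurable X]setTI.
    by apply: (measurable_funD (measurable_funM _ _) _).
  rewrite (ge0_integral_affine c ltr01) ?mul1e.
    apply: eq_integral => t _; rewrite /e -EFinM mul1r; congr (_%:E).
    by rewrite /M -normal_pdf01_shift addrK.
  - by [].
  - exact: measurable_funTS.
  - by move=> t _; exact: e0.
have dFG (A : set R) : measurable A ->
    (forall t, A t -> (M * expR (c * t))%:E <= h t)%E -> (G A <= F A)%E.
  move=> mA He; rewrite FE// GE//; apply: ge0_le_integral => //.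
  - exact: measurable_funTS.
  - exact: measurable_funTS.
  - by move=> t At; apply: lee_wpmul2l; [exact: ltW|exact: He].
have dGF (A : set R) : measurable A ->
    (forall t, A t -> h t <= (M * expR (c * t))%:E)%E -> (F A <= G A)%E.
  move=> mA He; rewrite FE// GE//; apply: ge0_le_integral => //.
  - exact: measurable_funTS.
  - exact: measurable_funTS.
  - by move=> t At; apply: lee_wpmul2l; [exact: ltW|exact: He].
have cdfX z : cdf X z = F `]-oo, z]%classic by [].
have cdfY z : cdf Y (z - c) = G `]-oo, z]%classic.
  rewrite /cdf /distribution /pushforward /G; congr (Q _).
  by apply/seteqP; split => w /=; rewrite !in_itv/= lerBrDr.
rewrite cdfX !cdfY => GFx; rewrite leNgt; apply/negP => FGy.
have cFX z : (F `]-oo, z]%classic + F `]z, +oo[%classic = 1)%E.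
  exact: cdf_ccdf_1.
have cGY z : (G `]-oo, z]%classic + G `]z, +oo[%classic = 1)%E.
  rewrite -cdfY -(cdf_ccdf_1 Y (z - c)); congr (_ + Q _)%E.
  by apply/seteqP; split => w /=; rewrite !in_itv/= !andbT ltrBlDr.
have Fy : F `]-oo, y]%classic \is a fin_num by rewrite -cdfX fin_num_measure.
have Gy : G `]-oo, y]%classic \is a fin_num by rewrite -cdfY fin_num_measure.
have int_split (g : R -> \bar R) : measurable_fun setT g -> (forall t, 0 <= g t)%E ->
    (\int[mu]_(t in `]-oo, y]) g t =
     \int[mu]_(t in `]-oo, x]) g t + \int[mu]_(t in `]x, y]) g t)%E.
  move=> mg g0; rewrite -ge0_integral_setU//=.
  - by rewrite -itv_bndbnd_setU//= bnd_simp ltW.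
  - exact: measurable_funTS.
  - rewrite disj_set2E; apply/eqP; rewrite -subset0 => t [] /=; rewrite !in_itv/=.
    by move=> tx /andP[xt _]; move: (lt_le_trans xt tx); rewrite ltxx.
have [p px hp] : exists2 p : R, p <= x & ((M * expR (c * p))%:E <= h p)%E.
  apply: contrapT => /forall2NP H; move: GFx; apply/negP; rewrite -leNgt.
  apply: dGF => // t /=; rewrite in_itv/= => tx; rewrite leNgt; apply/negP => /ltW ht.
  by case: (H t).
(* Both laws have mass 1, so the inequality at [y] is reversed on the upper tails. *)
have [r yr hr] : exists2 r : R, y < r & ((M * expR (c * r))%:E <= h r)%E.
  apply: contrapT => /forall2NP H; move: FGy; apply/negP; rewrite -leNgt cdfX.
  have : (F `]y, +oo[%classic <= G `]y, +oo[%classic)%E.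
    apply: dGF => // t /=; rewrite in_itv/= andbT => yt.
    by rewrite leNgt; apply/negP => /ltW ht; case: (H t).
  have <- : (1 - F `]-oo, y]%classic = F `]y, +oo[%classic)%E.
    by rewrite -(cFX y) addeAC subee ?add0e.
  have <- : (1 - G `]-oo, y]%classic = G `]y, +oo[%classic)%E.
    by rewrite -(cGY y) addeAC subee ?add0e.
  by rewrite leeD2lE// leeN2.
have [q /andP[xq qy] hq] : exists2 q : R, x < q <= y & (h q < (M * expR (c * q))%:E)%E.
  apply: contrapT => /forall2NP H; move: FGy; apply/negP; rewrite -leNgt cdfX.
  rewrite FE// GE// !int_split// -!FE// -!GE//; apply: leeD; first exact: ltW.
  apply: dFG => // t /=; rewrite in_itv/= => /andP[xt ty].
  by rewrite leNgt; apply/negP => ht; case: (H t) => //; rewrite xt ty.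
move: hq; rewrite ltNge => /negP; apply.
exact: (lh M c p q r (expR_gt0 _) (le_lt_trans px xq) (le_lt_trans qy yr)).
Qed.

End density_crossing.

(** * Densities of sums, products and square roots *)

Section change_of_density.
Context d (T : measurableType d) (R : realType).
Variables (mu nu : {measure set T -> \bar R}) (p : T -> \bar R).
Hypotheses (p0 : forall x, (0 <= p x)%E) (mp : measurable_fun setT p).
Hypothesis nuE : forall A, measurable A -> nu A = (\int[mu]_(x in A) p x)%E.
Local Open Scope ereal_scope.

Import HBNNSimple.

Lemma ge0_integral_density (f : T -> \bar R) : measurable_fun setT f ->
  (forall x, 0 <= f x) -> \int[nu]_x f x = \int[mu]_x (f x * p x).
Proof.
move=> mf f0; pose h := nnsfun_approx measurableT mf.
have cvg_h x : (h n x)%:E @[n --> \oo] --> f x by exact: cvg_nnsfun_approx.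
have nd_h x : {homo (fun n => (h n x)%:E) : a b / (a <= b)%N >-> a <= b}.
  by move=> a b ab; rewrite lee_fin; exact/lefP/nd_nnsfun_approx.
have le_h n x : (h n x)%:E <= f x.
  have /cvg_lim <- // := cvg_h x.
  apply: lime_ge; first by apply/cvg_ex; exists (f x).
  by exists n => // m /=; exact: nd_h.
have cvg_hp x : (h n x)%:E * p x @[n --> \oo] --> f x * p x.
  move: (p0 x); case: (p x) => [r _|_|//]; first exact: cvgeZr.
  (* Where [p x = +oo] the products are eventually constant: 0 if [f x = 0], and [+oo] once the
     approximation of [f x > 0] is positive. *)
  have [fx0|fx0] := eqVneq (f x) 0.
    rewrite fx0 mul0e; apply: cvg_near_cst; apply: nearW => n.
    rewrite (_ : (h n x)%:E = 0) ?mul0e//.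
    by apply/le_anti; rewrite -{1}fx0 le_h/= lee_fin.
  have {}fx0 : 0 < f x by rewrite lt_def fx0 f0.
  rewrite gt0_muley//; apply: cvg_near_cst.
  have : nbhs (f x) [set z : \bar R | 0 < z].
    by apply: open_nbhs_nbhs; split => //=; exact: open_ereal_gt_ereal.
  move/(cvg_h x); rewrite nbhs_filterE /= => h_gt0.
  by apply: filterS h_gt0 => n /= hn; rewrite gt0_muley.
have mh n : measurable_fun setT (fun x => (h n x)%:E).
  exact/measurable_EFinP.
have h0 n x : 0 <= (h n x)%:E by rewrite lee_fin.
transitivity (limn (fun n => \int[nu]_x (h n x)%:E)).
  rewrite -monotone_convergence//.
  by apply: eq_integral => x _; apply/esym/cvg_lim => //; exact: cvg_h.
transitivity (limn (fun n => \int[mu]_x ((h n x)%:E * p x))); last first.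
  rewrite -monotone_convergence//.
  - by apply: eq_integral => x _; apply/cvg_lim => //; exact: cvg_hp.
  - by move=> n; exact: emeasurable_funM.
  - by move=> n x _; exact: mule_ge0.
  - by move=> x _ a b ab; apply: lee_wpmul2r => //; exact: nd_h.
congr (limn _); apply/funext => n.
have preim_meas r : measurable (h n @^-1` [set r]) by exact: measurable_funPTI.
have indic0 r x : 0 <= (r * \1_(h n @^-1` [set r]) x)%:E.
  exact: nnfun_muleindic_ge0.
have mindic r : measurable_fun setT (fun x => (r * \1_(h n @^-1` [set r]) x)%:E).
  by apply/measurable_EFinP; exact: measurable_funM.
under eq_integral do rewrite fimfunE -fsumEFin//.
rewrite ge0_integral_fsum//.
under [RHS]eq_integral => x _.
  rewrite fimfunE -fsumEFin// ge0_mule_fsuml; last by move=> r; exact: indic0.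
  over.
rewrite [RHS]ge0_integral_fsum//; last 2 first.
- by move=> r; exact: emeasurable_funM.
- by move=> r x _; apply: mule_ge0.
apply: eq_fsbigr => r /[!inE] -[x0 _ <-].
have r0 : (0 <= h n x0)%R by [].
under eq_integral do rewrite EFinM.
under [RHS]eq_integral do rewrite EFinM -muleA.
have mind : measurable_fun setT
    (fun x => (\1_(h n @^-1` [set h n x0]) x)%:E : \bar R).
  exact/measurable_EFinP.
have mindp : measurable_fun setT
    (fun x => (\1_(h n @^-1` [set h n x0]) x)%:E * p x).
  exact: emeasurable_funM.
have ind0 x : 0 <= (\1_(h n @^-1` [set h n x0]) x)%:E :> \bar R by rewrite lee_fin.
rewrite ge0_integralZl ?lee_fin// [RHS]ge0_integralZl ?lee_fin//; last first.
  by move=> x _; exact: mule_ge0.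
congr (_ * _); rewrite integral_indic// setIT nuE// integral_mkcond.
apply: eq_integral => x _; rewrite /patch indicE.
by case: ifP => _; rewrite ?mul1e ?mul0e.
Qed.

End change_of_density.

Section joint_density.
Context {R : realType}.
Local Notation mu := (@lebesgue_measure R).
Local Open Scope ereal_scope.

Definition has_density d (T : measurableType d) (P : probability T R)
    (X : T -> R) (p : R -> \bar R) : Prop :=
  [/\ forall x, 0 <= p x, measurable_fun setT p &
      has_law P X (fun A => \int[mu]_(x in A) p x)].

(** [E] is an event of probability [c] independent of the pair: the whole space, or a value of the
    random sign with [c = 1/2]. The law of [(X, Y)] on [E], divided by [c], agrees with the product
    law on rectangles, hence everywhere. *)
Lemma joint_law_density d (T : measurableType d) (P : probability T R)
    (E : set T) (c : R) (X Y : {RV P >-> R}) (p q : R -> \bar R) :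
  measurable E -> (0 < c)%R -> has_density P X p -> has_density P Y q ->
  (forall A B : set R, measurable A -> measurable B ->
    P (E `&` (X @^-1` A `&` Y @^-1` B)) =
    c%:E * (P (X @^-1` A) * P (Y @^-1` B))) ->
  forall B : set (R * R), measurable B ->
    P (E `&` [set w | B (X w, Y w)]) =
    c%:E * \int[mu]_x (p x * \int[mu]_(y in xsection B x) q y).
Proof.
move=> mE c0 [p0 mp lX] [q0 mq lY] XY B mB.
pose rT := measurableTypeR R.
have mX : measurable_fun setT (X : T -> rT).
  by have : measurable_fun setT (X : T -> R) by [].
have mY : measurable_fun setT (Y : T -> rT).
  by have : measurable_fun setT (Y : T -> R) by [].
pose X' : {mfun T >-> rT} :=
  HB.pack (X : T -> rT) (isMeasurableFun.Build _ _ _ _ (X : T -> rT) mX).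
pose Y' : {mfun T >-> rT} :=
  HB.pack (Y : T -> rT) (isMeasurableFun.Build _ _ _ _ (Y : T -> rT) mY).
have mXY : measurable_fun setT (fun w => (X' w, Y' w)).
  exact: measurable_fun_pair.
have ci0 : (0 <= c^-1)%R by rewrite invr_ge0 ltW.
pose m' : {measure set (rT * rT) -> \bar R} :=
  mscale (NngNum ci0) (pushforward_measure (mrestr P mE) mXY).
have m'E A : m' A = c^-1%:E * P (E `&` [set w | A (X w, Y w)]).
  by rewrite /m'/= /mscale/= /pushforward /mrestr setIC.
have XYE := @product_measure_unique _ _ _ _ R (distribution P X') (distribution P Y') m'.
have -> : P (E `&` [set w | B (X w, Y w)]) = c%:E * m' B.
  by rewrite m'E muleA -EFinM divff ?mul1e// gt_eqF.
congr (_ * _); rewrite -XYE//; last first.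
  move=> A1 A2 mA1 mA2; rewrite m'E.
  have -> : [set w | (A1 `*` A2) (X w, Y w)] = X @^-1` A1 `&` Y @^-1` A2 by [].
  by rewrite XY// muleA -EFinM mulVf ?mul1e// gt_eqF.
rewrite /product_measure1/=.
rewrite (@ge0_integral_density _ _ _ mu (distribution P X') p p0 mp lX)//; last first.
  exact: measurable_fun_xsection.
apply: eq_integral => x _; rewrite muleC; congr (_ * _).
by rewrite /= /distribution /pushforward lY//; exact: measurable_xsection.
Qed.

Lemma tonelli_set (A : set R) (f : R -> R -> \bar R) : measurable A ->
  measurable_fun setT (fun z : R * R => f z.1 z.2) ->
  (forall x y, 0 <= f x y) ->
  \int[mu]_x \int[mu]_(y in A) f x y = \int[mu]_(y in A) \int[mu]_x f x y.
Proof.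
move=> mA mf f0.
pose g (z : R * R) := f z.1 z.2 * (\1_A z.2)%:E.
have g0 z : 0 <= g z by rewrite mule_ge0// lee_fin.
have mg : measurable_fun setT g.
  apply: emeasurable_funM => //; apply/measurable_EFinP.
  by apply: (measurableT_comp (measurable_indic mA)); exact: measurable_snd.
have patchE (h : R -> \bar R) y : (h \_ A) y = h y * (\1_A y)%:E.
  by rewrite /patch indicE; case: ifP => _; rewrite ?mule1 ?mule0.
transitivity (\int[mu]_x \int[mu]_y g (x, y)).
  apply: eq_integral => x _; rewrite [LHS]integral_mkcond.
  by apply: eq_integral => y _; rewrite patchE.
rewrite fubini_tonelli//= [RHS]integral_mkcond.
apply: eq_integral => y _; rewrite (patchE (fun y => \int[mu]_x f x y)).
rewrite -ge0_integralZr//.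
exact: (measurableT_comp mf (pair2_measurable y)).
Qed.

Lemma normal_pdf_affine (s m t : R) : (0 < s)%R ->
  (s * normal_pdf m s (s * t + m))%R = normal_pdf 0 1 t.
Proof.
move=> s0; rewrite !normal_pdf_expR ?oner_neq0 ?gt_eqF// mulrA; congr (_ * expR _)%R.
  rewrite /normal_peak expr1n mul1r -mulrnAr sqrtrM ?sqr_ge0// sqrtr_sqr gtr0_norm//.
  by rewrite invfM mulrA divff ?mul1r// gt_eqF.
by rewrite subr0 expr1n addrK; field; rewrite gt_eqF.
Qed.

(** Both sides factor the bivariate normal density with unit variances and correlation [r]. *)
Lemma normal_pdf_exchange (s r x y : R) : s != 0%R -> (s ^+ 2 + r ^+ 2 = 1)%R ->
  (normal_pdf 0 1 x * normal_pdf (r * x) s y)%R =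
  (normal_pdf 0 1 y * normal_pdf (r * y) s x)%R.
Proof.
move=> s0 sr; rewrite !normal_pdf_expR ?oner_neq0//.
rewrite mulrACA [in RHS]mulrACA -!expRD; congr (_ * expR _)%R.
have E u v : (- (u - 0) ^+ 2 / (1 ^+ 2 *+ 2) +
    - (v - r * u) ^+ 2 / (s ^+ 2 *+ 2) =
    - (u ^+ 2 * (s ^+ 2 + r ^+ 2) + v ^+ 2 - 2 * r * u * v) / (s ^+ 2 *+ 2))%R.
  by field.
by rewrite !E sr; congr (_ / _)%R; ring.
Qed.

Lemma measurable_normal_pdf2 (s r : R) : s != 0%R ->
  measurable_fun setT (fun z : R * R => normal_pdf (r * z.1) s z.2).
Proof.
move=> s0; under eq_fun do rewrite normal_pdf_expR//.
apply: measurable_funM => //; apply: measurableT_comp => //.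
apply: measurable_funM => //; apply: measurableT_comp => //.
apply: measurable_funX; apply: measurable_funB; first exact: measurable_snd.
by apply: measurable_funM => //; exact: measurable_fst.
Qed.

(** Given [L = l] the sum is normal with mean [r l] and standard deviation [s]. After Tonelli,
    [normal_pdf_exchange] takes [phi(y)] out of the integral over [l], and what remains is a
    smoothing of [g] at mean [r y]. *)
Lemma sum_law_density d (T : measurableType d) (P : probability T R)
    (s r : R) (N L : {RV P >-> R}) (g : R -> \bar R) :
  (0 < s)%R -> (s ^+ 2 + r ^+ 2 = 1)%R ->
  measurable_fun setT g -> (forall l, 0 <= g l) ->
  has_law P N (normal_prob 0 1) ->
  has_density P L (fun l => (normal_pdf 0 1 l)%:E * g l) -> indep2 N L ->
  has_law P (fun w => N w * s + L w * r)%R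
    (fun A => \int[mu]_(y in A) ((normal_pdf 0 1 y)%:E *
       \int[mu]_l ((normal_pdf (r * y) s l)%:E * g l))).
Proof.
move=> s0 sr mg g0 lN dL NL A mA.
have dN : has_density P N (fun x => (normal_pdf 0 1 x)%:E).
  split => //; first by move=> x; rewrite lee_fin normal_pdf_ge0.
  by apply/measurable_EFinP; exact: measurable_normal_pdf.
pose B := [set z : R * R | A (z.2 * s + z.1 * r)%R].
have mB : measurable B.
  have mh : measurable_fun setT (fun z : R * R => z.2 * s + z.1 * r)%R.
    by apply: measurable_funD; apply: measurable_funM.
  by rewrite /B -[X in measurable X]setTI; exact: mh.
have := joint_law_density measurableT ltr01 dL dN _ mB.
rewrite mul1e setTI => -> //; last first.
  by move=> A1 A2 mA1 mA2; rewrite setTI mul1e setIC NL// muleC.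
pose f l y := (normal_pdf 0 1 l)%:E * g l * (normal_pdf (r * l) s y)%:E.
have phi0 m s' x : 0 <= (normal_pdf m s' x : R)%:E by rewrite lee_fin normal_pdf_ge0.
have mphi m s' : measurable_fun setT (fun x : R => (normal_pdf m s' x)%:E).
  by apply/measurable_EFinP; exact: measurable_normal_pdf.
have sN0 : s != 0%R by rewrite gt_eqF.
have inner l : \int[mu]_(y in xsection B l) (normal_pdf 0 1 y)%:E =
    \int[mu]_(y in A) (normal_pdf (r * l) s y)%:E.
  rewrite [RHS](ge0_integral_affine (r * l) s0)//; last exact: measurable_funTS.
  rewrite (_ : _ @^-1` A = xsection B l); last first.
    by apply/seteqP; split => t; rewrite /xsection/= inE /B/= (mulrC t) (mulrC l).
  have mx : measurable_fun setT (fun t : R => (normal_pdf (r * l) s (s * t + r * l))%:E).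
    apply: (measurableT_comp (mphi _ _)).
    by apply: measurable_funD => //; exact: measurable_funM.
  rewrite -ge0_integralZl_EFin ?(ltW s0)//.
  - by apply: eq_integral => t _; rewrite -EFinM normal_pdf_affine.
  - exact: measurable_xsection.
  - exact: measurable_funTS.
transitivity (\int[mu]_l \int[mu]_(y in A) f l y).
  apply: eq_integral => l _; rewrite inner /f ge0_integralZl//.
  - exact: (measurable_funTS (mphi _ _)).
  - by rewrite mule_ge0.
rewrite tonelli_set//; last 2 first.
- apply: emeasurable_funM.
    apply: emeasurable_funM; first exact: (measurableT_comp (mphi _ _) measurable_fst).
    exact: (measurableT_comp mg measurable_fst).
  by apply/measurable_EFinP; exact: measurable_normal_pdf2.
- by move=> x y; rewrite /f !mule_ge0.
apply: eq_integral => y _.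
have mkg : measurable_fun setT (fun l => (normal_pdf (r * y) s l)%:E * g l).
  by apply: emeasurable_funM => //; exact: mphi.
have kg0 l : setT l -> 0 <= (normal_pdf (r * y) s l)%:E * g l.
  by move=> _; exact: mule_ge0.
rewrite -(ge0_integralZl mu measurableT mkg kg0 (phi0 _ _ _)).
apply: eq_integral => l _; rewrite /f muleAC -EFinM normal_pdf_exchange//.
by rewrite EFinM muleA.
Qed.

(** For fixed [x > 0] the substitution [y = z / x] has Jacobian [1 / x]. The inverse is written as a
    real power, which is nonnegative for every [x], so Tonelli applies before the sign of [x] is
    examined. *)
Lemma product_law_density d (T : measurableType d) (P : probability T R)
    (E : set T) (c : R) (X Y : {RV P >-> R}) (p q : R -> \bar R) :
  measurable E -> (0 < c)%R -> has_density P X p -> has_density P Y q ->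
  (forall x, (x <= 0)%R -> p x = 0) ->
  (forall A B : set R, measurable A -> measurable B ->
    P (E `&` (X @^-1` A `&` Y @^-1` B)) =
    c%:E * (P (X @^-1` A) * P (Y @^-1` B))) ->
  forall A : set R, measurable A ->
    P (E `&` [set w | A (X w * Y w)%R]) =
    c%:E * \int[mu]_(z in A) \int[mu]_x
      (p x * ((x `^ (-1))%:E * q (x `^ (-1) * z)%R)).
Proof.
move=> mE c0 dX dY pneg XY A mA.
have [p0 mp _] := dX; have [q0 mq _] := dY.
pose B := [set z : R * R | A (z.1 * z.2)%R].
have mB : measurable B.
  have mh : measurable_fun setT (fun z : R * R => z.1 * z.2)%R.
    by apply: measurable_funM.
  by rewrite /B -[X in measurable X]setTI; exact: mh.
rewrite (joint_law_density mE c0 dX dY XY mB); congr (_ * _).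
have minv : measurable_fun setT (fun x : R => x `^ (-1))%R.
  exact: measurable_powR.
have mqx : measurable_fun setT (fun z : R * R => q (z.1 `^ (-1) * z.2)%R).
  apply: (measurableT_comp mq); apply: measurable_funM => //.
  exact: (measurableT_comp minv measurable_fst).
rewrite -tonelli_set//; last 2 first.
- apply: emeasurable_funM; first exact: (measurableT_comp mp measurable_fst).
  apply: emeasurable_funM => //; apply/measurable_EFinP.
  exact: (measurableT_comp minv measurable_fst).
- by move=> x y; rewrite !mule_ge0// lee_fin powR_ge0.
apply: eq_integral => x _; have [x0|x0] := leP x 0%R.
  rewrite pneg// mul0e; under [RHS]eq_integral do rewrite mul0e.
  by rewrite integral0.
have mqx1 : measurable_fun setT (fun z : R => q (x `^ (-1) * z)%R).
  exact: (measurableT_comp mqx (pair1_measurable x)).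
rewrite ge0_integralZl//; last 2 first.
- by apply: measurable_funeM; exact: (measurable_funTS mqx1).
- by move=> y _; rewrite mule_ge0// lee_fin powR_ge0.
congr (_ * _).
rewrite ge0_integralZl_EFin ?powR_ge0//; last exact: (measurable_funTS mqx1).
have xi0 : (0 < x `^ (-1))%R by rewrite powR_gt0.
rewrite (ge0_integral_affine 0 xi0)//; last 2 first.
- exact: measurable_xsection.
- exact: (measurable_funTS mq).
congr (_ * _); rewrite (_ : _ @^-1` _ = A).
  by apply: eq_integral => z _; rewrite addr0.
apply/seteqP; split => z; rewrite /xsection/= inE /B/= addr0 mulrA powR_inv1 ?(ltW x0)//.
  by rewrite divff ?mul1r// gt_eqF.
by rewrite divff ?mul1r// gt_eqF.
Qed.

End joint_density.

(** * Square roots and random signs *)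

Section density_measure.
Context d (T : measurableType d) (R : realType).
Variables (mu : {measure set T -> \bar R}) (p : T -> \bar R).
Hypotheses (p0 : forall x, (0 <= p x)%E) (mp : measurable_fun setT p).

(** The two proofs are arguments so that the measure structure can be attached to the term. *)
Definition density_measure of (forall x, 0 <= p x)%E & measurable_fun setT p :=
  fun A : set T => (\int[mu]_(x in A) p x)%E.

Local Notation dens := (density_measure p0 mp).

Let density_measure0 : dens set0 = 0%E.
Proof. exact: integral_set0. Qed.

Let density_measure_ge0 A : (0 <= dens A)%E.
Proof. exact: integral_ge0. Qed.

Let density_measure_sigma_additive : semi_sigma_additive dens.
Proof.
move=> F mF tF mUF; rewrite /density_measure ge0_integral_bigcup//; last first.
  exact: measurable_funTS.
by apply: is_cvg_ereal_nneg_natsum_cond => n _ _; exact: integral_ge0.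
Qed.

HB.instance Definition _ := isMeasure.Build _ _ _ dens
  density_measure0 density_measure_ge0 density_measure_sigma_additive.

End density_measure.

Section sqrt_substitution.
Context {R : realType}.
Local Notation mu := (@lebesgue_measure R).
Local Notation rT := (measurableTypeR R).

Let pos : set rT := `]0, +oo[%classic.

Let measurable_pos : measurable pos.
Proof. exact: measurable_itv. Qed.

Let sqrt_map (z : rT) : rT := Num.sqrt z.

Let measurable_sqrt_map : measurable_fun setT sqrt_map.
Proof.
by apply: continuous_measurable_fun; exact: sqrt_continuous.
Qed.

Let jacobian (y : R) : \bar R := (2 * Num.max 0 y)%:E.

Let jacobian_ge0 y : (0 <= jacobian y)%E.
Proof. by rewrite lee_fin mulr_ge0// le_max lexx. Qed.

Let measurable_jacobian : measurable_fun setT jacobian.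
Proof.
apply/measurable_EFinP; apply: measurable_funM => //; exact: measurable_maxr.
Qed.

(** [Num.sqrt] sends negative numbers to 0; without the restriction to [pos] the image measure would
    have an infinite atom there. *)
Let sqrt_measure := pushforward_measure (mrestr mu measurable_pos) measurable_sqrt_map.

Let sqrt_measure_itv (a b : R) :
  sqrt_measure `]a, b]%classic = (\int[mu]_(y in `]a, b]) jacobian y)%E /\
  (sqrt_measure `]a, b]%classic < +oo)%E.
Proof.
pose a' := Num.max 0 a.
have -> : (\int[mu]_(y in `]a, b]) jacobian y =
    \int[mu]_(y in `]a', b]) (2 * y)%:E)%E.
  rewrite [LHS]integral_mkcond [RHS]integral_mkcond.
  apply: eq_integral => y _; rewrite !patchE !mem_setE !in_itv/= /a' gt_max /jacobian.
  have [y0|y0] := leP y 0; last by rewrite andTb.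
  by rewrite mulr0; case: ifP.
have a'0 : 0 <= a' by rewrite /a' le_max lexx.
have E : sqrt_map @^-1` `]a, b] `&` pos =
    if a' < b then `]a' ^+ 2, b ^+ 2]%classic else set0.
  have lt_sqrt z : 0 < z -> a < Num.sqrt z -> a' < Num.sqrt z.
    by move=> z0 az; rewrite /a' gt_max sqrtr_gt0 z0.
  case: ifPn => ab.
    have b0 : 0 < b by exact: le_lt_trans ab.
    apply/seteqP; split => z; rewrite /pos/= !in_itv/= ?andbT.
      move=> [/andP[az zb] z0]; rewrite -{1}(sqr_sqrtr (ltW z0)) -{2}(sqr_sqrtr (ltW z0)).
      rewrite ltr_pXn2r ?nnegrE ?sqrtr_ge0// lt_sqrt//=.
      by rewrite ler_pXn2r ?nnegrE ?sqrtr_ge0// ltW.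
    move=> /andP[az zb]; have z0 : 0 < z by rewrite (le_lt_trans _ az)// sqr_ge0.
    split=> //; apply/andP; split; last first.
      by rewrite -(ger0_norm (ltW b0)) -sqrtr_sqr ler_wsqrtr.
    apply: (@le_lt_trans _ _ a'); first by rewrite /a' le_max lexx orbT.
    by rewrite -(ger0_norm a'0) -sqrtr_sqr ltr_sqrt.
  rewrite -subset0 => z; rewrite /pos/= !in_itv/= andbT => -[/andP[az zb] z0].
  by move: ab; rewrite (lt_le_trans (lt_sqrt _ z0 az) zb).
rewrite /sqrt_measure/= /pushforward /mrestr E; case: ifPn => ab; last first.
  by rewrite measure0 set_itv_ge ?integral_set0 ?ltry// bnd_simp.
have b0 : 0 < b by exact: le_lt_trans ab.
rewrite lebesgue_measure_itv/= lte_fin ltr_pXn2r ?nnegrE ?(ltW b0)// ab; split; last by rewrite -EFinD ltry.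
have dF (x : R) : is_derive x 1 (fun y : R => y ^+ 2) (2 * x).
  by apply: is_derive_eq; rewrite /GRing.scale/=; ring.
rewrite (integral_itv_is_derive (F := fun y => y ^+ 2))//; first exact: ltW.
exact: mulrl_continuous.
Qed.

Let sqrt_measureE (A : set R) : measurable A ->
  sqrt_measure A = (\int[mu]_(y in A) jacobian y)%E.
Proof.
move=> mA.
pose lam : {measure set rT -> \bar R} :=
  density_measure mu jacobian_ge0 measurable_jacobian.
apply: (@measure_unique _ R rT (@ocitv R)
  (fun n => `](- n%:R), n%:R]%classic) _ _ _ _ sqrt_measure lam) => //.
- exact: ocitvI.
- by move=> n; exact: is_ocitv.
- apply/seteqP; split => // x _.
  exists (Num.bound `|x|) => //=; rewrite in_itv/=.
  have xb := archi_boundP (normr_ge0 x).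
  rewrite ltrNl (le_lt_trans _ xb) ?ler_normr ?lexx ?orbT//=.
  by rewrite (le_trans (ler_norm x))// ltW.
- by move=> _ [[a b] _ <-]; exact: (sqrt_measure_itv a b).1.
- by move=> k; exact: (sqrt_measure_itv _ _).2.
Qed.

Lemma ge0_integral_sqrt (w : R -> \bar R) (A : set R) : measurable A ->
  measurable_fun setT w -> (forall z, 0 <= w z)%E ->
  (forall z, z <= 0 -> w z = 0%E) ->
  (\int[mu]_(z in (@Num.sqrt R) @^-1` A) w z =
   \int[mu]_(y in A) (w (y ^+ 2)%R * (2 * Num.max 0 y)%:E))%E.
Proof.
move=> mA mw w0 wneg.
pose h (y : rT) : \bar R := (w (y ^+ 2)%R * (\1_A y)%:E)%E.
have mh : measurable_fun setT h.
  apply: emeasurable_funM.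
    by apply: (measurableT_comp mw); exact: measurable_funX.
  by apply/measurable_EFinP; exact: measurable_indic.
have h0 y : (0 <= h y)%E by rewrite mule_ge0// lee_fin.
have patchE (f : R -> \bar R) (B : set R) y :
    (f \_ B) y = (f y * (\1_B y)%:E)%E.
  by rewrite /patch indicE; case: ifP => _; rewrite ?mule1 ?mule0.
transitivity (\int[sqrt_measure]_y h y)%E; last first.
  rewrite (ge0_integral_density (mu := mu) (nu := sqrt_measure)
    jacobian_ge0 measurable_jacobian sqrt_measureE)//.
  rewrite [RHS]integral_mkcond; apply: eq_integral => y _.
  by rewrite patchE /h muleAC.
rewrite /sqrt_measure /= ge0_integral_pushforward//=.
rewrite preimage_setT.
have restrE (B : set rT) : measurable B ->
    mrestr mu measurable_pos B = (\int[mu]_(x in B) (\1_pos x)%:E)%E.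
  by move=> mB; rewrite integral_indic// setIC.
rewrite (ge0_integral_density (mu := mu) (nu := mrestr mu measurable_pos) _ _ restrE)//; last 2 first.
- by apply/measurable_EFinP; exact: measurable_indic.
- exact: (measurableT_comp mh measurable_sqrt_map).
rewrite [LHS]integral_mkcond; apply: eq_integral => z _; rewrite patchE /h /=.
have [z0|z0] := leP z 0.
  rewrite wneg// mul0e (_ : \1_pos z = 0 :> R) ?mule0//.
  by rewrite indicE memNset// /pos/= in_itv/= andbT; apply/negP; rewrite -leNgt.
rewrite (_ : \1_pos z = 1 :> R); last first.
  by rewrite indicE mem_set// /pos/= in_itv/= z0.
by rewrite mule1 /sqrt_map sqr_sqrtr ?(ltW z0)// !indicE.
Qed.

End sqrt_substitution.

Lemma probability_ae_eq d (T : measurableType d) (R : realType)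
    (P : probability T R) (A B : set T) : measurable A -> measurable B ->
  (\forall w \ae P, A w <-> B w) -> P A = P B.
Proof.
move=> mA mB [N [mN N0 AB]].
rewrite -(measureU0 mA mN N0) -(measureU0 mB mN N0); congr (P _).
have h w : ~ N w -> (A w <-> B w) by move=> Nw; apply: contrapT => /AB.
apply/seteqP; split => w; have [Nw _|/h ABw] := pselect (N w); try (by right);
  by move=> [/ABw|]; [left|right].
Qed.

Lemma ge0_integral_opp (R : realType) (f : R -> \bar R) (A : set R) :
  measurable A -> measurable_fun A f -> (forall x, A x -> 0 <= f x)%E ->
  (\int[@lebesgue_measure R]_(x in A) f x =
   \int[@lebesgue_measure R]_(x in -%R @^-1` A) f (- x)%R)%E.
Proof.
move=> mA mf f0.
have mopp : measurable_fun setT (-%R : measurableTypeR R -> measurableTypeR R).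
  by have : measurable_fun setT (-%R : R -> R) by [].
rewrite -(ge0_integral_pushforward mopp)//.
  rewrite (eq_measure_integral (pushforward_measure (@lebesgue_measure R) mopp))//.
  by move=> B mB _; exact/esym/lebesgue_measureN.
by move=> x /[!inE]; exact: f0.
Qed.

Section symmetrized_square_root.
Context {R : realType} d (T : measurableType d) (P : probability T R).
Local Notation mu := (@lebesgue_measure R).
Variables (S W L : {RV P >-> R}) (w : R -> \bar R).
Hypotheses (mw : measurable_fun setT w) (w0 : forall z, (0 <= w z)%E).
Hypothesis wneg : forall z, z <= 0 -> w z = 0%E.
Hypothesis S1 : P (S @^-1` [set 1]) = (1 / 2)%:E.
Hypothesis SN1 : P (S @^-1` [set (-1)]) = (1 / 2)%:E.
Hypothesis SW : forall (s : R) (A : set R), s = 1 \/ s = -1 -> measurable A ->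
  P (S @^-1` [set s] `&` W @^-1` A) = ((1 / 2)%:E * \int[mu]_(z in A) w z)%E.
Hypothesis LE : \forall x \ae P, L x = S x * Num.sqrt (W x).

(** On [S = 1] the variable is [sqrt W], on [S = -1] it is [- sqrt W]. Each half contributes with
    weight 1/2 the Jacobian [2 max(0, y)], respectively [2 max(0, - y)], and these add up to
    [|y|]. *)
Lemma symmetrized_square_root_density (A : set R) : measurable A ->
  P (L @^-1` A) = (\int[mu]_(l in A) (w (l ^+ 2)%R * `|l|%:E))%E.
Proof.
move=> mA.
have mS (s : R) : measurable (S @^-1` [set s]) by exact: measurable_funPTI.
have mAN : measurable (-%R @^-1` A).
  by rewrite -[X in measurable X]setTI; exact: oppr_measurable.
have msqrt (B : set R) : measurable B -> measurable (@Num.sqrt R @^-1` B).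
  move=> mB; rewrite -[X in measurable X]setTI.
  by apply: continuous_measurable_fun => //; exact: sqrt_continuous.
have disj : S @^-1` [set 1] `&` S @^-1` [set (-1)] = set0.
  rewrite -preimage_setI (_ : _ `&` _ = set0) ?preimage_set0//.
  rewrite -subset0 => x /= [-> /eqP]; rewrite -subr_eq0 opprK.
  by rewrite gt_eqF// addr_gt0.
(* The two atoms of mass 1/2 exhaust the law of [S]. *)
have Sae : \forall x \ae P, S x = 1 \/ S x = -1.
  exists (~` (S @^-1` [set 1] `|` S @^-1` [set (-1)])); split.
  - by apply: measurableC; exact: measurableU.
  - rewrite probability_setC; last exact: measurableU.
    have SU := etrans (measureU P (mS 1) (mS (-1)) disj) (congr2 adde S1 SN1).
    have half : 1 / 2 + 1 / 2 = 1 :> R by field.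
    by rewrite SU -EFinD half subrr.
  - by [].
pose B1 := S @^-1` [set 1] `&` W @^-1` (@Num.sqrt R @^-1` A).
pose B2 := S @^-1` [set (-1)] `&` W @^-1` (@Num.sqrt R @^-1` (-%R @^-1` A)).
have mB1 : measurable B1.
  by apply: measurableI => //; apply: measurable_funPTI; exact: msqrt.
have mB2 : measurable B2.
  by apply: measurableI => //; apply: measurable_funPTI; exact: msqrt.
have -> : P (L @^-1` A) = P (B1 `|` B2).
  apply: probability_ae_eq.
  - exact: measurable_funPTI.
  - exact: measurableU.
  - apply: filterS2 Sae LE => x Sx Lx; rewrite /B1 /B2/= Lx.
    split; first by case: Sx => ->; rewrite ?mul1r ?mulN1r; [left|right].
    by move=> [] [-> ]; rewrite ?mul1r ?mulN1r.
have B12 : B1 `&` B2 = set0 by rewrite /B1 /B2 setIACA disj set0I.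
have PU : P (B1 `|` B2) = (P B1 + P B2)%E := measureU P mB1 mB2 B12.
have PB1 : P B1 = _ := SW (or_introl erefl) (msqrt A mA).
have PB2 : P B2 = _ := SW (or_intror erefl) (msqrt _ mAN).
rewrite PU PB1 PB2 !ge0_integral_sqrt// {PU PB1 PB2}.
have mw2 : measurable_fun setT (fun y : R => w (y ^+ 2)).
  by apply: (measurableT_comp mw); exact: measurable_funX.
have mj (B : set R) (g : R -> R) : measurable_fun setT g ->
    measurable_fun B (fun y => (w (y ^+ 2)%R * (g y)%:E)%E).
  by move=> mg; apply: measurable_funTS; apply: emeasurable_funM => //; exact/measurable_EFinP.
have mmax (g : R -> R) : measurable_fun setT g ->
    measurable_fun setT (fun y => 2 * Num.max 0 (g y)).
  by move=> mg; apply: measurable_funM => //; exact: measurable_maxr.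
have mpos2 : measurable_fun A
    (fun y => (w ((- y) ^+ 2)%R * (2 * Num.max 0 (- y))%:E)%E).
  under eq_fun do rewrite sqrrN.
  by apply: (mj A (fun y => 2 * Num.max 0 (- y))); exact: mmax.
rewrite [X in (_ + _ * X)%E]ge0_integral_opp//; last 2 first.
- by apply: mj; exact: mmax.
- by move=> y _; rewrite mule_ge0// lee_fin mulr_ge0// le_max lexx.
rewrite (_ : -%R @^-1` (-%R @^-1` A) = A); last first.
  by apply/seteqP; split => y /=; rewrite opprK.
rewrite -ge0_muleDr; last 2 first.
- by apply: integral_ge0 => y _; rewrite mule_ge0// lee_fin mulr_ge0// le_max lexx.
- by apply: integral_ge0 => y _; rewrite mule_ge0// lee_fin mulr_ge0// le_max lexx.
rewrite -ge0_integralD//; last 3 first.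
- by move=> y _; rewrite mule_ge0// lee_fin mulr_ge0// le_max lexx.
- by apply: mj; exact: mmax.
- by move=> y _; rewrite mule_ge0// lee_fin mulr_ge0// le_max lexx.
rewrite -ge0_integralZl_EFin//; last 2 first.
- move=> y _; by rewrite adde_ge0// mule_ge0// lee_fin mulr_ge0// le_max lexx.
- by apply: emeasurable_funD; [apply: mj; exact: mmax|exact: mpos2].
apply: eq_integral => y _; rewrite sqrrN -ge0_muleDr ?lee_fin ?mulr_ge0 ?le_max ?lexx//.
rewrite muleCA -EFinD -EFinM; congr (_ * _%:E)%E.
have [y0|y0] := leP 0 y.
  have -> : Num.max 0 (- y) = 0 by apply/max_idPl; rewrite oppr_le0.
  by rewrite ger0_norm//; field.
have -> : Num.max 0 (- y) = - y by apply/max_idPr; rewrite oppr_ge0 ltW.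
by rewrite ltr0_norm//; field.
Qed.

End symmetrized_square_root.

(** * The law of [L_{K,a}] *)

Lemma nondecreasing_emeasurable (R : realType) (G : R -> \bar R) :
  {homo G : s t / s <= t >-> (s <= t)%E} -> measurable_fun setT G.
Proof.
move=> ndG; apply: (measurability _ (ErealGenCInfty.measurableE R)) => /= _ [_ [r ->] <-].
rewrite setTI; apply: is_interval_measurable => s t /=.
rewrite !in_itv/= !andbT => rs rt u /andP[su ut].
by rewrite in_itv/= andbT (le_trans rs)// ndG.
Qed.

Section law_of_L.
Context {R : realType} d (T : measurableType d) (P : probability T R).
Local Notation mu := (@lebesgue_measure R).

(* Density of the square of [L_{K,a}], up to a constant factor. *)
Definition sqr_pdf (G : R -> \bar R) (r z : R) : \bar R :=
  ((if 0 < z then z `^ (- 2^-1) * expR (- z / 2) else 0)%:E * G (r - z)%R)%E.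

Lemma measurable_sqr_pdf (G : R -> \bar R) (r : R) :
  {homo G : s t / s <= t >-> (s <= t)%E} -> measurable_fun setT (sqr_pdf G r).
Proof.
move=> ndG; apply: emeasurable_funM; last first.
  apply: (measurableT_comp (nondecreasing_emeasurable ndG)).
  exact: measurable_funB.
apply/measurable_EFinP; apply: measurable_fun_ifT => //.
  exact: measurable_fun_ltr.
apply: measurable_funM; first exact: measurable_powR.
apply: measurableT_comp => //; exact: measurable_funM.
Qed.

(** At [z = l^2] the factor [z^(-1/2)] cancels the Jacobian [|l|], and [e^(-z/2)] is [phi(l)]
    divided by [normal_peak 1]. *)
Lemma density_of_square (S W L : {RV P >-> R}) (G : R -> \bar R) (r C : R) :
  0 <= C -> (forall s, 0 <= G s)%E -> {homo G : s t / s <= t >-> (s <= t)%E} ->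
  P (S @^-1` [set 1]) = (1 / 2)%:E -> P (S @^-1` [set (-1)]) = (1 / 2)%:E ->
  (forall (s : R) (A : set R), s = 1 \/ s = -1 -> measurable A ->
    P (S @^-1` [set s] `&` W @^-1` A) =
    ((1 / 2)%:E * \int[mu]_(z in A) (C%:E * sqr_pdf G r z))%E) ->
  (\forall x \ae P, L x = S x * Num.sqrt (W x)) ->
  has_density P L (fun l => (normal_pdf 0 1 l)%:E *
    ((C / normal_peak 1)%:E * G (r - l ^+ 2)%R))%E.
Proof.
move=> C0 G0 ndG S1 SN1 SW LE.
have peak0 : 0 < normal_peak (1 : R) by rewrite normal_peak_gt0// oner_neq0.
have mG2 : measurable_fun setT (fun l : R => G (r - l ^+ 2)).
  apply: (measurableT_comp (nondecreasing_emeasurable ndG)).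
  by apply: measurable_funB => //; exact: measurable_funX.
have mres : measurable_fun setT (fun l => (normal_pdf 0 1 l)%:E *
    ((C / normal_peak 1)%:E * G (r - l ^+ 2)%R))%E.
  apply: emeasurable_funM; last exact: measurable_funeM.
  by apply/measurable_EFinP; exact: measurable_normal_pdf.
split => //.
  move=> l; apply: mule_ge0; first by rewrite lee_fin normal_pdf_ge0.
  by rewrite mule_ge0// lee_fin divr_ge0 ?(ltW peak0).
move=> A mA.
have sq0 z : (0 <= sqr_pdf G r z)%E.
  by rewrite mule_ge0// lee_fin; case: ifP => // _; rewrite mulr_ge0 ?powR_ge0 ?expR_ge0.
have msq : measurable_fun setT (fun z => C%:E * sqr_pdf G r z)%E.
  by apply: measurable_funeM; exact: measurable_sqr_pdf.
rewrite (symmetrized_square_root_density msq _ _ S1 SN1 SW LE)//; last 2 first.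
- by move=> z; rewrite mule_ge0.
- by move=> z z0; rewrite /sqr_pdf ltNge z0/= mul0e mule0.
(* The cancellation fails at [l = 0], a null set that is removed from both integrals. *)
have mA0 : measurable (A `\ 0) by exact: measurableD.
rewrite -[LHS](integral_setD1 mA0); last first.
  apply: measurable_funTS; apply: emeasurable_funM.
    by apply: (measurableT_comp msq); exact: measurable_funX.
  by apply/measurable_EFinP; exact: normr_measurable.
rewrite -[RHS](integral_setD1 mA0); last exact: (measurable_funTS mres).
apply: eq_integral => l; rewrite inE => -[_ /= /eqP l0].
have l20 : 0 < l ^+ 2 by rewrite exprn_even_gt0.
rewrite /sqr_pdf l20 -muleA [(_ * `|l|%:E)%E]muleC.
rewrite !muleA -!EFinM; congr (_%:E * _)%E.
rewrite powRN powR12_sqrt ?sqr_ge0// sqrtr_sqr normal_pdf_expR ?oner_neq0//.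
have -> : - (l - 0) ^+ 2 / (1 ^+ 2 *+ 2) = - l ^+ 2 / 2 by field.
by field; rewrite normr_eq0 l0 gt_eqF.
Qed.

Lemma chi2_truncated_density (K : nat) (r : R) (X : {RV P >-> R}) :
  has_law P X (cond_law (chi2_prob K) `]-oo, r]) ->
  exists2 k : R, 0 <= k & has_density P X (fun x =>
    (k * (if 0 < x <= r then x `^ (K%:R / 2 - 1) * expR (- x / 2) else 0))%:E).
Proof.
move=> lX; set C := `]-oo, r]%classic in lX.
(* That [X] has this law already forces the truncation event to have finite nonzero mass: with mass
   0 or [+oo] the quotient would be 0. *)
have nuCT : (chi2_prob K C / chi2_prob K C = 1)%E.
  by rewrite -(probability_setT P) (lX setT)// /cond_law setTI.
pose Z : R := 2 `^ (K%:R / 2) * gamma_fun (K%:R / 2).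
have Z0 : 0 <= Z.
  rewrite mulr_ge0 ?powR_ge0//; apply: Rintegral_ge0 => t _.
  by rewrite mulr_ge0 ?powR_ge0 ?expR_ge0.
have pdf0 (x : R) : 0 <= chi2_pdf K x.
  rewrite /chi2_pdf; case: ifP => // _; apply: divr_ge0; last exact: Z0.
  by rewrite mulr_ge0 ?powR_ge0 ?expR_ge0.
have nuC0 : (0 <= chi2_prob K C)%E.
  by apply: integral_ge0 => x _; rewrite lee_fin.
have [c c0 cE] : exists2 c : R, 0 <= c & ((chi2_prob K C)^-1 = c%:E)%E.
  move: nuCT nuC0; case: (chi2_prob K C) => [y| |//].
    move=> h y0; exists y^-1; first by rewrite invr_ge0.
    have [y00|y00] := eqVneq y 0; last by rewrite inver (negbTE y00).
    by move: h; rewrite y00 mul0e => /eqP; rewrite eqe eq_sym oner_eq0.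
  by rewrite invey mule0 => /eqP; rewrite eqe eq_sym oner_eq0.
exists (Z^-1 * c); first by rewrite mulr_ge0 ?invr_ge0.
have mbase : measurable_fun setT (fun x : R => x `^ (K%:R / 2 - 1) * expR (- x / 2)).
  apply: measurable_funM; first exact: measurable_powR.
  by apply: measurableT_comp => //; exact: measurable_funM.
have mpdf : measurable_fun setT (fun x : R => (chi2_pdf K x)%:E).
  apply/measurable_EFinP; apply: measurable_fun_ifT => //.
    exact: measurable_fun_ltr.
  exact: measurable_funM.
split.
- move=> x; rewrite lee_fin mulr_ge0 ?mulr_ge0 ?invr_ge0//; case: ifP => // _.
  by rewrite mulr_ge0 ?powR_ge0 ?expR_ge0.
- apply/measurable_EFinP; apply: measurable_funM => //.
  apply: measurable_fun_ifT => //.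
  by apply: measurable_and; [exact: measurable_fun_ltr|exact: measurable_fun_ler].
move=> A mA; rewrite (lX A)// /cond_law cE /chi2_prob integral_mkcondr.
rewrite -ge0_integralZr//.
- apply: eq_integral => x _; rewrite patchE mem_setE in_itv/= /chi2_pdf -/Z.
  case: ifPn => xr; last by rewrite andbF mulr0 mul0e.
  rewrite andbT -EFinM; congr (_%:E); case: ifP => _; last by rewrite mul0r mulr0.
  ring.
- apply: measurable_funTS; apply/(measurable_restrictT _ _).1.
    exact: measurable_itv.
  exact: (measurable_funTS mpdf).
- by move=> x _; apply: erestrict_ge0 => y _; rewrite lee_fin.
Qed.

Lemma betaR_density (p q : R) (X : {RV P >-> R}) :
  has_law P X (betaR_prob p q) ->
  exists2 k : R, 0 <= k & has_density P X (fun x =>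
    (k * (if 0 < x < 1 then x `^ (p - 1) * (1 - x) `^ (q - 1) else 0))%:E).
Proof.
move=> lX; exists (betaR_fun p q)^-1.
  rewrite invr_ge0; apply: Rintegral_ge0 => t _.
  by rewrite mulr_ge0 ?powR_ge0.
have b0 : 0 <= betaR_fun p q.
  by apply: Rintegral_ge0 => t _; rewrite mulr_ge0 ?powR_ge0.
split.
- move=> x; rewrite lee_fin mulr_ge0 ?invr_ge0//; case: ifP => // _.
  by rewrite mulr_ge0 ?powR_ge0.
- apply/measurable_EFinP; apply: measurable_funM => //.
  apply: measurable_fun_ifT => //.
    by apply: measurable_and; exact: measurable_fun_ltr.
  apply: measurable_funM; first exact: measurable_powR.
  by apply: (measurableT_comp (measurable_powR _)); exact: measurable_funB.
move=> A mA; rewrite (lX A)// /betaR_prob; apply: eq_integral => x _.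
by congr (_%:E); rewrite /betaR_pdf; case: ifP => _; rewrite ?mulr0// mulrC.
Qed.

End law_of_L.

Lemma powR_exp (R : realType) (x e : R) : 0 < x -> x `^ e = expR (e * ln x).
Proof. by move=> x0; rewrite /powR gt_eqF. Qed.

(** Substituting [y = x - z], the powers of [x] cancel, [(x - z)^((K-3)/2)] becomes the power in the
    gamma integrand, and [e^(-x/2)] splits into [e^(-z/2) e^(-y/2)]. The truncation [x <= r] becomes
    [y <= r - z]. *)
Lemma chi2_beta_product_kernel (R : realType) (K : nat) (r k1 k2 z : R) :
  0 <= k1 -> 0 <= k2 ->
  let mu := @lebesgue_measure R in
  let p x := (k1 * (if 0 < x <= r then x `^ (K%:R / 2 - 1) * expR (- x / 2)
                    else 0))%:E in
  let q t := (k2 * (if 0 < t < 1 then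
    t `^ (1 / 2 - 1) * (1 - t) `^ ((K%:R - 1) / 2 - 1) else 0))%:E in
  (\int[mu]_x (p x * ((x `^ (-1))%:E * q (x `^ (-1) * z)%R)) =
   (k1 * k2)%:E * sqr_pdf (lower_gamma ((K%:R - 1) / 2 - 1)) r z)%E.
Proof.
move=> k10 k20 mu p q; rewrite /sqr_pdf.
have xi (x : R) : 0 < x -> x `^ (-1) = x^-1 by move=> x0; rewrite powR_inv1// ltW.
case: ifPn => z0; last first.
  rewrite mul0e mule0; apply: integral0_eq => x _; rewrite /p /q.
  case: ifPn => [/andP[x0 _]|_]; last by rewrite mulr0 mul0e.
  rewrite xi// ifF ?mulr0 ?mule0//; apply/negbTE; rewrite negb_and -leNgt.
  by rewrite pmulr_rle0 ?invr_gt0// leNgt z0.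
set al := _ - 1; rewrite /lower_gamma.
pose gam (y : R) := y `^ al * expR (- y / 2).
have gam0 y : 0 <= gam y by exact: lower_gamma_integrand_ge0.
have mgam : measurable_fun setT (fun y => (gam y)%:E).
  exact: measurable_lower_gamma_integrand.
rewrite (ge0_integral_affine (- z) ltr01)//=; last 2 first.
- exact: (measurable_funTS mgam).
- by move=> y _; rewrite lee_fin; exact: gam0.
rewrite mul1e (_ : _ @^-1` _ = `]z, r]%classic); last first.
  by apply/seteqP; split => x /=; rewrite !in_itv/= mul1r subr_gt0 lerBDr subrK.
have mg : measurable_fun setT (fun x : R => (gam (1 * x - z))%:E).
  by apply: (measurableT_comp mgam); apply: measurable_funD.
have c0 : 0 <= z `^ (- 2^-1) * expR (- z / 2).
  by rewrite mulr_ge0 ?powR_ge0 ?expR_ge0.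
rewrite -/mu muleA -EFinM -ge0_integralZl_EFin//; last 3 first.
- by move=> x _; rewrite lee_fin; exact: gam0.
- exact: (measurable_funTS mg).
- by rewrite !mulr_ge0 ?powR_ge0 ?expR_ge0.
rewrite [RHS]integral_mkcond; apply: eq_integral => x _.
rewrite patchE mem_setE in_itv/= /p /q.
have [xz|zx] := leP x z.
  case: ifPn => [/andP[x0 _]|_]; last by rewrite mulr0 mul0e.
  rewrite xi// ifF ?mulr0 ?mule0//; apply/negbTE; rewrite negb_and -!leNgt.
  by rewrite [X in _ || (1 <= X)]mulrC ler_pdivlMr// mul1r xz orbT.
have x0 := lt_trans z0 zx; rewrite x0/=.
case: ifPn => xr; last by rewrite mulr0 mul0e.
have xz0 : 0 < x - z by rewrite subr_gt0.
have xz1 : 0 < x `^ (-1) * z by rewrite mulr_gt0 ?powR_gt0.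
have xz1E : 1 - x `^ (-1) * z = x `^ (-1) * (x - z).
  by rewrite xi//; field; rewrite gt_eqF.
rewrite xz1 -subr_gt0 xz1E mulr_gt0 ?powR_gt0//= -!EFinM; congr (_%:E).
rewrite /gam (mul1r x) !powR_exp ?mulr_gt0 ?expR_gt0//.
rewrite !lnM ?posrE ?expR_gt0// expRK.
set lx := ln x; set lz := ln z; set lxz := ln (x - z).
transitivity (k1 * k2 * (expR ((K%:R / 2 - 1) * lx) * expR (- x / 2) *
  (expR (-1 * lx) * (expR ((1 / 2 - 1) * (-1 * lx + lz)) *
     expR (al * (-1 * lx + lxz)))))); first ring.
by rewrite -[RHS]mulrA -!expRD; congr (_ * expR _); rewrite /al; field.
Qed.

Section law_of_L_density.
Context {R : realType} d (T : measurableType d) (P : probability T R).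
Local Notation mu := (@lebesgue_measure R).

(** [rho = 1] uses the log-concavity of [g], [0 < rho < 1] that of its smoothings. The latter is a
    separate clause because it has two sources: the smoothing lemma when [g] has bounded support,
    and a direct computation when [g] is constant. *)
Definition gaussian_logconcave_law (L : {RV P >-> R}) : Prop :=
  exists g : R -> \bar R,
    [/\ measurable_fun setT g, forall l, (0 <= g l)%E, logconcave g,
        forall sigma, sigma != 0 ->
          logconcave (fun m => \int[mu]_l ((normal_pdf m sigma l)%:E * g l))%E &
        has_density P L (fun l => (normal_pdf 0 1 l)%:E * g l)%E].

Lemma gaussian_logconcave_law_normal (L : {RV P >-> R}) :
  has_law P L (normal_prob 0 1) -> gaussian_logconcave_law L.
Proof.
move=> lL; exists (fun=> 1%E); split => //.
- exact: logconcave_cst.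
- move=> sigma _; rewrite (_ : (fun m => _) = (fun=> 1%E)); last first.
    apply/funext => m; rewrite -[RHS](integral_normal_pdf m sigma).
    by apply: eq_integral => l _; rewrite mule1.
  exact: logconcave_cst.
- under eq_fun do rewrite mule1; split => //.
  + by move=> x; rewrite lee_fin normal_pdf_ge0.
  + by apply/measurable_EFinP; exact: measurable_normal_pdf.
Qed.

Lemma gaussian_logconcave_law_square (S W L : {RV P >-> R})
    (G : R -> \bar R) (r C : R) :
  0 <= C -> (forall s, 0 <= G s)%E -> {homo G : s t / s <= t >-> (s <= t)%E} ->
  (forall s, s < 0 -> G s = 0%E) -> logconcave G ->
  P (S @^-1` [set 1]) = (1 / 2)%:E -> P (S @^-1` [set (-1)]) = (1 / 2)%:E ->
  (forall (s : R) (A : set R), s = 1 \/ s = -1 -> measurable A ->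
    P (S @^-1` [set s] `&` W @^-1` A) =
    ((1 / 2)%:E * \int[mu]_(z in A) (C%:E * sqr_pdf G r z))%E) ->
  (\forall x \ae P, L x = S x * Num.sqrt (W x)) -> gaussian_logconcave_law L.
Proof.
move=> C0 G0 ndG Gneg lG S1 SN1 SW LE.
exists (fun l : R => (C / normal_peak 1)%:E * G (r - l ^+ 2)%R)%E.
have C'0 : 0 <= C / normal_peak 1 by rewrite divr_ge0 ?normal_peak_ge0.
have mg : measurable_fun setT (fun l : R => (C / normal_peak 1)%:E * G (r - l ^+ 2)%R)%E.
  apply: measurable_funeM; apply: (measurableT_comp (nondecreasing_emeasurable ndG)).
  by apply: measurable_funB => //; exact: measurable_funX.
have g0 (l : R) : (0 <= (C / normal_peak 1)%:E * G (r - l ^+ 2)%R)%E.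
  by rewrite mule_ge0.
have lg : logconcave (fun l : R => (C / normal_peak 1)%:E * G (r - l ^+ 2)%R)%E.
  by apply: logconcaveZ => //; exact: logconcave_sub_sqr.
split => //; last exact: density_of_square LE.
move=> sigma s0; apply: (@logconcave_normal_smoothing _ _ s0 _ (Num.sqrt r)) => //.
move=> l rl; rewrite Gneg ?mule0// subr_lt0.
have [r0|r0] := leP r 0.
  rewrite (le_lt_trans r0)// exprn_even_gt0//= -normr_gt0.
  by rewrite (le_lt_trans _ rl)// sqrtr_ge0.
by rewrite -(real_normK (num_real l)) -{1}(sqr_sqrtr (ltW r0)) ltr_pXn2r
  ?nnegrE ?sqrtr_ge0.
Qed.

Lemma is_L_law (K : nat) (a : \bar R) (L : {RV P >-> R}) :
  (1 <= K)%N -> is_L K a L ->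
  (\forall w \ae P, L w = 0) \/ gaussian_logconcave_law L.
Proof.
move=> K1; case: a => [r| |] /=; last by [].
- case: ifPn => [r0|_ [_ ?]]; last by left.
  move=> [chi [S [beta [ind [chi0 lchi] [SN1 S1] lbeta LE]]]]; right.
  pose X : {RV P >-> R} := chi \* chi.
  have [k k0 dX] := @chi2_truncated_density _ _ _ P K r X lchi.
  have joint (s : R) (A B : set R) : s = 1 \/ s = -1 ->
      measurable A -> measurable B ->
      (P (S @^-1` [set s] `&` (X @^-1` A `&` beta @^-1` B)) =
       (1 / 2)%:E * (P (X @^-1` A) * P (beta @^-1` B)))%E.
    move=> sE mA mB; pose A' := [set x : R | A (x * x)].
    have mA' : measurable A'.
      have msq : measurable_fun setT (fun x : R => x * x) by exact: measurable_funM.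
      by rewrite /A' -[X in measurable X]setTI; exact: msq.
    have Shalf : P (S @^-1` [set s]) = (1 / 2)%:E by case: sE => ->.
    have := ind A' [set s] B mA' (measurable_set1 s) mB.
    rewrite Shalf [(P (chi @^-1` A') * _)%E]muleC -muleA => <-; congr (P _).
    by rewrite setIA [S @^-1` _ `&` _]setIC.
  (* For [K = 1] the law of [beta] is a point mass, without density, so the square of [L] is taken
     to be [X] itself instead of the product [X * beta]. *)
  have [{}K1|NK1] := eqVneq K 1%N.
  + subst K; have beta1 : \forall w \ae P, beta w = 1.
      have m1 : measurable (beta @^-1` [set 1]) by exact: measurable_funPTI.
      exists (~` (beta @^-1` [set 1])); split => //; first exact: measurableC.
      rewrite probability_setC// (lbeta _ (measurable_set1 1)) /beta_law eqxx.
      by rewrite diracE mem_set// subee.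
    apply: (@gaussian_logconcave_law_square S X L
      (fun s => if 0 <= s then 1%E else 0%E) r k) => //.
    * by move=> s; case: ifP => // _; rewrite lee_fin.
    * move=> s t st; case: ifPn => s0; first by rewrite (le_trans s0 st).
      by case: ifP => // _; rewrite lee_fin.
    * by move=> s s0; rewrite leNgt s0.
    * exact: logconcave_step.
    * move=> s A sE mA; have := joint s A setT sE mA measurableT.
      rewrite preimage_setT setIT probability_setT mule1 => ->; congr (_ * _)%E.
      have [_ _ lX] := dX; rewrite (lX A mA); apply: eq_integral => x _.
      rewrite /sqr_pdf subr_ge0; case: (leP x r) => xr; last first.
        by rewrite andbF mulr0 !mule0.
      rewrite andbT mule1 -EFinM; congr (_ * _)%:E; case: ifP => // _.
      by congr (_ `^ _ * _); field.
    * apply: filterS3 chi0 beta1 LE => w c0 b1 ->.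
      rewrite /X/= b1 sqrtr1 mulr1 mulrC; congr (_ * _).
      by rewrite -expr2 sqrtr_sqr ger0_norm.
  + move: lbeta; rewrite /beta_law (negbTE NK1) => /betaR_density[k2 k20 dbeta].
    apply: (@gaussian_logconcave_law_square S (X \* beta) L
      (lower_gamma ((K%:R - 1) / 2 - 1)) r (k * k2)) => //.
    * by rewrite mulr_ge0.
    * by move=> s; apply: integral_ge0 => y _; rewrite lee_fin lower_gamma_integrand_ge0.
    * exact: le_lower_gamma.
    * by move=> s s0; rewrite lower_gamma_le0// ltW.
    * exact: logconcave_lower_gamma.
    * move=> s A sE mA.
      have mE : measurable (S @^-1` [set s]) by exact: measurable_funPTI.
      have half0 : 0 < 1 / 2 :> R by rewrite divr_gt0.
      have := product_law_density mE half0 dX dbeta _ (fun A B mA mB => joint s A B sE mA mB) mA.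
      move=> ->; last by move=> x x0; rewrite ltNge x0 mulr0.
      congr (_ * _)%E; apply: eq_integral => z _.
      exact: chi2_beta_product_kernel.
    * apply: filterS2 chi0 LE => w c0 ->.
      rewrite /X/= sqrtrM ?mulr_ge0// -expr2 sqrtr_sqr ger0_norm//; ring.
- by move=> lL; right; exact: gaussian_logconcave_law_normal.
Qed.

End law_of_L_density.

(** No density is involved, so [s = 0] is allowed. A strict inequality at [x] yields an outcome [w]
    with [s N(w) <= x] and [N(w) > x - c]; since [s <= 1], every outcome with [N <= y - c] then
    satisfies [s N <= s N(w) + s (y - x) <= y]. *)
Lemma less_dispersed_contraction (R : realType) d (T : measurableType d)
    (P : probability T R) (N X : {RV P >-> R}) (s : R) : 0 <= s <= 1 ->
  (\forall w \ae P, X w = N w * s) -> less_dispersed X N.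
Proof.
move=> /andP[s0 s1] XE; apply: less_dispersed_of_crossing => c x y xy.
have mNs z : measurable [set w | N w * s <= z].
  have mh : measurable_fun setT (fun w => N w * s) by exact: measurable_funM.
  by rewrite -[X in measurable X]setTI; exact: (mh measurableT _ (measurable_itv `]-oo, z])).
have cdfX z : cdf X z = P [set w | N w * s <= z].
  apply: (@probability_ae_eq _ _ _ P (X @^-1` `]-oo, z])) => //.
    exact: measurable_funPTI.
  by apply: filterS XE => w /= ->; rewrite in_itv.
have cdfN z : cdf N z = P (N @^-1` `]-oo, z]) by [].
rewrite !cdfX !cdfN => lt_x.
have [w wx Nw] : exists2 w, N w * s <= x & x - c < N w.
  apply: contrapT => /forall2NP H; move: lt_x; apply/negP; rewrite -leNgt.
  apply: le_measure; rewrite ?inE//; first exact: measurable_funPTI.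
  move=> w /= wx; rewrite in_itv/= leNgt; apply/negP => h.
  by case: (H w).
apply: le_measure; rewrite ?inE//; first exact: measurable_funPTI.
move=> w' /=; rewrite in_itv/= => w'y.
have h1 : N w' * s <= (y - c) * s by rewrite ler_wpM2r.
have h2 : (x - c) * s <= N w * s by rewrite ler_wpM2r// ltW.
have h3 : (y - x) * s <= y - x by rewrite ler_piMr// subr_ge0 ltW.
lra.
Qed.

Theorem theorem3 (R : realType) (d : measure_display) (T : measurableType d)
    (P : probability T R) (a : \bar R) (K : nat) (rho : R)
    (eps0 L : {RV P >-> R}) :
  (0 <= a)%E -> (1 <= K)%N -> 0 <= rho <= 1 ->
  has_law P eps0 (normal_prob 0 1) ->
  is_L K a L ->
  indep2 eps0 L ->
  less_dispersed
    (Num.sqrt (1 - rho ^+ 2) \o* eps0 \+ rho \o* L : {RV P >-> R}) eps0.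
Proof.
move=> _ K1 /andP[rho0 rho1] leps lL indepL.
set s := Num.sqrt (1 - rho ^+ 2).
have rho2 : 0 <= 1 - rho ^+ 2 by rewrite subr_ge0 expr_le1.
have s2 : s ^+ 2 + rho ^+ 2 = 1 by rewrite sqr_sqrtr// subrK.
have s01 : 0 <= s <= 1.
  by rewrite sqrtr_ge0/= -[leRHS]sqrtr1 ler_wsqrtr// gerBl sqr_ge0.
have [L0|[g [mg g0 lg smooth_g dL]]] := is_L_law K1 lL.
  apply: (less_dispersed_contraction s01).
  by apply: filterS L0 => w /= ->; rewrite mul0r addr0.
(* The rescaling of the smoothed function by [rho] requires [rho > 0]. *)
have [rho_eq0|rhoN0] := eqVneq rho 0.
  apply: (less_dispersed_contraction s01).
  by apply: nearW => w /=; rewrite rho_eq0 mulr0 addr0.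
have {rho0}rho_gt0 : 0 < rho by rewrite lt_def rhoN0.
(* Here [s = 0]: the sum is [L], and its own density relative to [phi] is used. *)
have [rho_eq1|rhoN1] := eqVneq rho 1.
  apply: (less_dispersed_normal_density mg g0 lg _ leps) => A mA.
  have [_ _ <-//] := dL; congr (P _); apply/seteqP.
  by split=> w /=; rewrite /s rho_eq1 expr1n subrr sqrtr0 mulr0 add0r mulr1.
have s_gt0 : 0 < s by rewrite sqrtr_gt0 subr_gt0 expr_lt1 ?lt_def 1?eq_sym ?rhoN1// ltW.
pose h y := (\int[@lebesgue_measure R]_l ((normal_pdf (rho * y) s l)%:E * g l))%E.
have kg0 y l : (0 <= (normal_pdf (rho * y) s l)%:E * g l)%E.
  by rewrite mule_ge0// lee_fin normal_pdf_ge0.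
have mh : measurable_fun setT h.
  pose f (z : R * R) := ((normal_pdf (rho * z.1) s z.2)%:E * g z.2)%E.
  apply: (@measurable_fun_fubini_tonelli_F _ _ _ _ R (@lebesgue_measure R) f).
    apply: emeasurable_funM; last exact: (measurableT_comp mg measurable_snd).
    by apply/measurable_EFinP; apply: measurable_normal_pdf2; rewrite gt_eqF.
  by move=> z; exact: kg0.
apply: (less_dispersed_normal_density mh _ _ _ leps).
- by move=> y; exact: integral_ge0.
- apply: (logconcave_scale (h := fun m =>
    (\int[@lebesgue_measure R]_l ((normal_pdf m s l)%:E * g l))%E) rho_gt0).
  by apply: smooth_g; rewrite gt_eqF.
- exact: (sum_law_density s_gt0 s2 mg g0 leps dL indepL).
Qed.
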